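(* Let $m \le n$ be positive integers, let $A \in \mathbb{Z}^{m \times n}$, and let $\tau$ be an $m$-element subset of $[n]=\{1,\ldots,n\}$ such that the $m\times m$ matrix $A_\tau$ is non-singular. Then there exists a set $\gamma$ with $\tau \subseteq \gamma \subseteq [n]$ such that $\mathcal{L}(A) = \mathcal{L}(A_\gamma)$ and $$|\gamma| \le m + \Omega_m\left( \frac{|\det(A_\tau)|}{\gcd(A)} \right).$$ Moreover, given $A$ and $\tau$, such a set $\gamma$ can be computed in polynomial time.
   Context: For $\gamma \subseteq [n]$, $A_\gamma$ denotes the $m \times |\gamma|$ submatrix of $A$ formed by the columns indexed by $\gamma$. For an integer matrix $M$ with $k$ columns, $\mathcal{L}(M) := \{ M x : x \in \mathbb{Z}^k\}$ is the lattice generated by the columns of $M$. For $A \in \mathbb{Z}^{m\times n}$ of rank $m$, $\gcd(A)$ denotes the (positive) greatest common divisor of all the $m\times m$ minors $\det(A_\gamma)$, where $\gamma$ ranges over the $m$-element subsets of $[n]$. For a positive integer $z$ with prime factorization $z = p_1^{s_1}\cdots p_k^{s_k}$ (distinct primes $p_i$, multiplicities $s_i \ge 1$), the truncated prime $\Omega$-function is $\Omega_m(z) := \sum_{i=1}^k \min\{s_i, m\}$ (so $\Omega_m(1)=0$). Polynomial time means polynomial in the binary encoding size of the input. *)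

(* Defs.v *)
From mathcomp Require Import all_boot all_order all_algebra.

Set Implicit Arguments.
Unset Strict Implicit.
Unset Printing Implicit Defensive.

Import Order.TTheory GRing.Theory Num.Theory.

Local Open Scope ring_scope.

(** * Column submatrices, lattices, minors *)

Definition cols (m n : nat) (A : 'M[int]_(m, n)) (g : {set 'I_n}) :
    'M[int]_(m, #|g|) :=
  colsub (fun k : 'I_#|g| => enum_val k) A.

Definition lattice (m k : nat) (M : 'M[int]_(m, k)) (v : 'cV[int]_m) : Prop :=
  exists x : 'cV[int]_k, v = M *m x.

(* [conform_mx] only retypes [cols A g] as a square matrix when [#|g| = m];
   the default value 0 is used for no other purpose than totality. *)
Definition minor (m n : nat) (A : 'M[int]_(m, n)) (g : {set 'I_n}) : int :=
  \det (conform_mx (0 : 'M[int]_m) (cols A g)).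

Definition gcd_minors (m n : nat) (A : 'M[int]_(m, n)) : nat :=
  \big[gcdn/0%N]_(g : {set 'I_n} | #|g| == m) `|minor A g|%N.

Definition trunc_Omega (m z : nat) : nat :=
  (\sum_(p <- primes z) minn (logn p z) m)%N.

(** * Polynomial time

    The machine model is the random-access machine with the logarithmic cost
    criterion (instructions +, -, *, / as in Aho, Hopcroft and Ullman), with
    structured control flow.  The memory consists of banks of integer cells;
    a program names its banks statically, so it uses finitely many of them,
    and addresses the cells of a bank indirectly.  All cells contain integers
    of arbitrary size, and every operation is charged the bit sizes of all the
    values involved, addresses included: running times are polynomially
    related to those of Turing machines. *)

(* Binary size of an integer, sign bit included: 1 + ceil (log2 (|z| + 1)). *)
Definition bitsize (z : int) : nat := (up_log 2 `|z|.+1).+1.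

Inductive binop := OpAdd | OpSub | OpMul | OpDiv | OpLeq.

Inductive expr :=
  | Const of int
  | Read of nat & expr
  | Bin of binop & expr & expr.

(* [Write b a e] writes the value of [e] at address [a] of bank [b]; the tests
   of [If] and [While] succeed on nonzero values. *)
Inductive cmd :=
  | Skip
  | Write of nat & expr & expr
  | Seq of cmd & cmd
  | If of expr & cmd & cmd
  | While of expr & cmd.

Definition memory := nat -> int -> int.

(* Division is Euclidean, with [x / 0 = 0]. *)
Definition eval_binop (o : binop) (x y : int) : int :=
  match o with
  | OpAdd => x + y
  | OpSub => x - y
  | OpMul => x * y
  | OpDiv => (x %/ y)%Z
  | OpLeq => if x <= y then 1 else 0
  end.

Fixpoint eval (s : memory) (e : expr) : int :=
  match e with
  | Const z => z
  | Read b a => s b (eval s a)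
  | Bin o e1 e2 => eval_binop o (eval s e1) (eval s e2)
  end.

Fixpoint eval_cost (s : memory) (e : expr) : nat :=
  (bitsize (eval s e) +
   match e with
   | Const _ => 0
   | Read _ a => eval_cost s a
   | Bin _ e1 e2 => eval_cost s e1 + eval_cost s e2
   end)%N.

Definition update (s : memory) (b : nat) (a z : int) : memory :=
  fun b' a' => if (b' == b) && (a' == a) then z else s b' a'.

(* [exec c s s' t]: started in memory [s], the program [c] halts in memory [s']
   after time [t]. *)
Inductive exec : cmd -> memory -> memory -> nat -> Prop :=
  | exec_skip s : exec Skip s s 1
  | exec_write b a e s :
      exec (Write b a e) s (update s b (eval s a) (eval s e))
        (eval_cost s a + eval_cost s e)
  | exec_seq c1 c2 s1 s2 s3 t1 t2 :
      exec c1 s1 s2 t1 -> exec c2 s2 s3 t2 -> exec (Seq c1 c2) s1 s3 (t1 + t2)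
  | exec_if e c1 c2 s s' t :
      exec (if eval s e != 0 then c1 else c2) s s' t ->
      exec (If e c1 c2) s s' (eval_cost s e + t)
  | exec_while_stop e c s :
      eval s e = 0 -> exec (While e c) s s (eval_cost s e)
  | exec_while_step e c s1 s2 s3 t1 t2 :
      eval s1 e != 0 -> exec c s1 s2 t1 -> exec (While e c) s2 s3 t2 ->
      exec (While e c) s1 s3 (eval_cost s1 e + t1 + t2).

(* The cells 0, 1, 2, ... of the bank contain [w] followed by zeros. *)
Definition bank (w : seq int) (a : int) : int :=
  if a is Posz i then nth 0 w i else 0.

Definition init_memory (w : seq int) : memory :=
  fun b => if b is 0 then bank w else fun=> 0.

(* Input in bank 0, output in bank 1. *)
Definition computes_within (c : cmd) (w w' : seq int) (T : nat) : Prop :=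
  exists s t, [/\ exec c (init_memory w) s t, s 1%N =1 bank w' & (t <= T)%N].

Definition word_size (w : seq int) : nat := (\sum_(z <- w) bitsize z)%N.

Definition set_word (n : nat) (g : {set 'I_n}) : seq int :=
  [seq (j \in g)%:Z | j <- enum 'I_n].

(* m, n, the entries of A row by row, and the characteristic vector of g. *)
Definition instance_word (m n : nat) (A : 'M[int]_(m, n)) (g : {set 'I_n}) :
    seq int :=
  [:: m%:Z, n%:Z & [seq A i j | i <- enum 'I_m, j <- enum 'I_n] ++ set_word g].

(* Main.v *)
(** Start from gamma = [n] and, for each column outside tau in turn, discard it
    if it lies in the lattice of the other remaining columns. The result is
    irredundant outside tau. Write A = B Y with Y right invertible over Z, so
    that |det A_tau| / gcd(A) = |det Y_tau| =: z. Each j in gamma \ tau is, for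
    some prime p dividing z, a coloop modulo p among the columns of Y_gamma. For
    fixed p the coloops number at most m - rank_p(Y_tau), which is at most m, and
    also at most the exponent of p in z by the Smith normal form of Y_tau.

    For the running time, fraction-free Gauss-Jordan elimination turns A into
    T = C A with C nonsingular, such that T_tau contains all the columns d e_i,
    where d is, up to sign, det A_tau. All entries are minors, hence short.
    Membership of a column in the lattice of others is then decided modulo d,
    by inserting the columns one by one into a triangular basis by Euclid's
    algorithm: a vector belongs to the lattice iff all its successive pivots
    are divisible by those of the basis. *)

Require Import Defs.
From mathcomp Require Import all_boot all_order all_algebra.
From mathcomp Require Import perm zify ring.

Set Implicit Arguments.
Unset Strict Implicit.
Unset Printing Implicit Defensive.

Import Order.TTheory GRing.Theory Num.Theory.

Local Open Scope ring_scope.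

(** * Irredundant generating sets *)

(** The coloops come from a local-global principle: an integer matrix with m rows generates Z^m as
    soon as it has rank m modulo every prime. Suppose j in gamma \ tau is a coloop modulo no prime
    dividing z. Then the columns of Y_gamma other than j still have rank m modulo every prime, those
    of tau being enough when p does not divide z; so they generate column j, against irredundance.
    Splitting off B is what makes the lattice of Y_gamma all of Z^m, the only lattice to which the
    principle applies.

    For the running time the obstacle is the growth of integers during triangulation. Since tau is
    never discarded, every tested lattice contains d Z^m, and all entries can be kept between 0 and
    d. While row i is being cleared, however, d e_r is known to be available only for r > i, so the
    reduction modulo d must be harmless in the rows up to i. A single K, quadratic in the input
    size, then bounds the bit size of every cell; times are counted in units of K. The existence
    statement is finally read off the run of the program. *)

Definition span_on (m n : nat) (A : 'M[int]_(m, n)) (g : {set 'I_n}) (v : 'cV[int]_m) :=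
  exists2 x : 'cV[int]_n, (forall j, j \notin g -> x j 0 = 0) & v = A *m x.

(** Coefficient vectors indexed by all columns and supported on [g] keep one type while [g] varies,
    unlike those of [cols A g]. *)
Lemma lattice_cols m n (A : 'M[int]_(m, n)) g v :
  lattice (cols A g) v <-> span_on A g v.
Proof.
split=> [[x ->]|[x x0 ->]].
  exists (\col_j \sum_(k < #|g| | enum_val k == j) x k 0).
    move=> j jg; rewrite mxE big1 // => k /eqP kj.
    by move: (enum_valP k); rewrite kj (negPf jg).
  apply/colP=> i; rewrite !mxE.
  transitivity (\sum_(k < #|g|) \sum_(j < n | enum_val k == j) A i j * x k 0).
    by apply: eq_bigr => k _; rewrite (big_pred1 (enum_val k)) ?mxE // => j; rewrite /= eq_sym.
  rewrite (exchange_big_dep xpredT) //=; apply: eq_bigr => j _.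
  by rewrite mxE mulr_sumr.
exists (\col_k x (enum_val k) 0).
apply/colP=> i; rewrite !mxE.
rewrite (bigID [in g]) /= addrC big1 ?add0r => [|j /x0 ->]; last by rewrite mulr0.
by rewrite big_enum_val; apply: eq_bigr => k _; rewrite !mxE.
Qed.

(** The equality of cardinals is eliminated here once and for all, so that later proofs never meet
    the retyping inside [minor]. *)
Lemma minor_colsub m n (g : {set 'I_n}) : #|g| = m ->
  exists f : 'I_m -> 'I_n,
    [/\ injective f, forall i, f i \in g, forall j, j \in g -> exists i, j = f i
      & forall B : 'M[int]_(m, n), minor B g = \det (colsub f B)].
Proof.
case: m /; exists enum_val; split.
- exact: enum_val_inj.
- exact: enum_valP.
- by move=> j jg; exists (enum_rank_in jg j); rewrite enum_rankK_in.
- by move=> B; rewrite /minor conform_mx_id.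
Qed.

(** A repeated column gives determinant 0, and otherwise reordering the columns only changes the
    sign. Arbitrary [f] are allowed because rank arguments select columns in no particular order. *)
Lemma gcd_minors_dvd m n (A : 'M[int]_(m, n)) (f : 'I_m -> 'I_n) :
  (gcd_minors A %| `|\det (colsub f A)|)%N.
Proof.
have [/injectiveP f_inj|/injectivePn[i [j ij fij]]] := boolP (injectiveb f); last first.
  rewrite -det_tr (determinant_alternate ij) ?dvdn0 // => k.
  by rewrite !mxE fij.
pose g := [set f i | i in 'I_m].
have gm : #|g| = m by rewrite card_imset // card_ord.
have [h [h_inj hg gh hdet]] := minor_colsub gm.
have /fin_all_exists[s hs] (i : 'I_m) : exists k, f i = h k by apply: gh; rewrite imset_f.
have s_inj : injective s by move=> i j sij; apply: f_inj; rewrite !hs sij.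
have -> : colsub f A = col_perm (perm s_inj) (colsub h A).
  by apply/matrixP=> i j; rewrite !mxE permE hs.
rewrite col_permE det_mulmx det_perm abszM absz_sign muln1 -hdet.
by apply: biggcdn_inf => //; apply/eqP.
Qed.

(** * Integer matrices modulo primes *)

Lemma Fp_eq0 p (z : int) : prime p -> ((z%:~R : 'F_p) == 0) = (p %| `|z|)%N.
Proof.
move=> p_pr; rewrite (dvdn_pcharf (pchar_Fp p_pr)).
by case: z => k //=; rewrite NegzE mulrNz oppr_eq0.
Qed.

Lemma map_intr_unitmx (F : fieldType) m (M : 'M[int]_m) :
  M \in unitmx -> map_mx (intr : int -> F) M \in unitmx.
Proof. by rewrite !unitmxE det_map_mx; apply: rmorph_unit. Qed.

(** In the Smith normal form, each diagonal entry that vanishes modulo [p] contributes a factor [p]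
    to the determinant, and there are at least as many of them as the corank. *)
Lemma pexp_corank_dvd_det p m (M : 'M[int]_m) : prime p ->
  (p ^ (m - \rank (map_mx (intr : int -> 'F_p) M)) %| `|\det M|)%N.
Proof.
move=> p_pr; have [L uL [R uR [d _ ->]]] := int_Smith_normal_form M.
set D := \matrix_(i, j) _; set f := (intr : int -> 'F_p).
pose K := [set i : 'I_m | (p %| `|(d`_i)%R|)%N].
have D_diag : D = diag_mx (\row_i d`_i) by apply/matrixP=> i j; rewrite !mxE.
have rankD : \rank (map_mx f (L *m D *m R)) = \rank (map_mx f D).
  rewrite !map_mxM mxrankMfree ?row_free_unit ?map_intr_unitmx //.
  by rewrite eqmxMfull // row_full_unit map_intr_unitmx.
have rankK : (m - \rank (map_mx f D) <= #|K|)%N.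
  rewrite leq_subLR.
  (* Adding 1 at the vanishing diagonal places makes [D] invertible modulo [p]; hence the ranks of
     [D] and [E] add up to at least [m], and [E] has at most [#|K|] nonzero rows. *)
  pose E : 'M['F_p]_m := diag_mx (\row_i (i \in K)%:R).
  have uDE : map_mx f D + E \in unitmx.
    rewrite D_diag map_diag_mx -raddfD /= unitmxE det_diag unitfE.
    apply/prodf_neq0 => i _; rewrite !mxE inE -Fp_eq0 //.
    by have [->|nz] := eqVneq ((d`_i)%:~R : 'F_p) 0; rewrite ?add0r ?oner_eq0 // addr0.
  rewrite -[X in (X <= _)%N](mxrank_unit uDE).
  apply: leq_trans (mxrank_add _ _) _; rewrite leq_add2l.
  apply: leq_trans (rank_leq_row (rowsub (fun k : 'I_#|K| => enum_val k) E)).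
  apply: mxrankS; apply/row_subP=> i; have [iK|iK] := boolP (i \in K).
    by rewrite -[i](enum_rankK_in iK iK) -row_rowsub row_sub.
  rewrite (_ : row i E = 0) ?sub0mx //; apply/rowP=> j; rewrite !mxE (negPf iK).
  by rewrite mul0rn.
rewrite rankD; apply: dvdn_trans (dvdn_exp2l p rankK) _.
rewrite !det_mulmx !abszM dvdn_mulr // dvdn_mull // D_diag det_diag.
rewrite (big_morph absz abszM absz1) (bigID [in K]) /= dvdn_mulr //.
rewrite -prod_nat_const; apply: (big_ind2 (fun x y => (x %| y)%N)) => //.
  by move=> ? ? ? ? ; apply: dvdn_mul.
by move=> i; rewrite inE mxE.
Qed.

(** The local-global principle: no prime divides an invariant factor, so all of them are units and
    the Smith form has a right inverse over the integers. *)
Lemma lattice_full m n (N : 'M[int]_(m, n)) :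
  (forall p, prime p -> \rank (map_mx (intr : int -> 'F_p) N) = m) ->
  forall v, lattice N v.
Proof.
have [L uL [R uR [d _ ->]]] := int_Smith_normal_form N.
set D := \matrix_(i, j) _ => rankN v.
have rankD p : prime p -> row_free (map_mx (intr : int -> 'F_p) D).
  move=> p_pr; rewrite /row_free -[X in _ == X](rankN p p_pr) !map_mxM.
  rewrite mxrankMfree ?row_free_unit ?map_intr_unitmx //.
  by rewrite eqmxMfull // row_full_unit map_intr_unitmx.
have le_mn : (m <= n)%N.
  by have /eqP <- := rankD 2 isT; apply: rank_leq_col.
have d1 (i : 'I_m) : `|(d`_i)%R|%N = 1%N.
  apply/eqP/negPn/negP => di1.
  have [p p_pr pd] : exists2 p, prime p & (p %| `|(d`_i)%R|)%N.
    have [->|d0] := eqVneq `|(d`_i)%R|%N 0; first by exists 2.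
    by exists (pdiv `|(d`_i)%R|); rewrite ?pdiv_dvd ?pdiv_prime //; lia.
  have /row_freeP[E /matrixP/(_ i i)] := rankD p p_pr.
  rewrite !mxE big1 => [/eqP|k _]; first by rewrite eqxx eq_sym oner_eq0.
  rewrite !mxE rmorphMn /= (eqP (_ : (d`_i)%:~R == 0)) ?mul0rn ?mul0r //.
  by rewrite Fp_eq0.
(* The invariant factors are 1 or -1, each its own inverse, so the transposed pattern is a right
   inverse of [D]. *)
pose E : 'M[int]_(n, m) := \matrix_(j, i) (d`_i *+ (i == j :> nat)).
have DE : D *m E = 1%:M.
  apply/matrixP=> i k; rewrite !mxE (bigD1 (widen_ord le_mn i)) //= big1 => [|j].
    rewrite !mxE /= eqxx eq_sym -val_eqE /= mulr1n addr0.
    have [<-|] := eqVneq (i : nat) k; last by rewrite mulr0.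
    by have := d1 i; case: (d`_i)%R => -[|[]].
  rewrite !mxE -val_eqE /= eq_sym => /negPf ->; by rewrite mul0r.
exists (invmx R *m E *m invmx L *m v).
by rewrite !mulmxA mulmxK // -(mulmxA L) DE mulmx1 mulmxV // mul1mx.
Qed.

(** * Coloops and rank *)

Section RowSpace.
Variables (F : fieldType) (n m : nat) (V : 'M[F]_(n, m)).

Definition row_space (X : {set 'I_n}) : 'M[F]_m := (\sum_(j in X) <<row j V>>)%MS.

Lemma row_sub_space (X : {set 'I_n}) j : j \in X -> (row j V <= row_space X)%MS.
Proof. by move=> jX; apply: sumsmx_sup jX _; rewrite genmxE. Qed.

Lemma row_space_sub (X : {set 'I_n}) p (B : 'M[F]_(p, m)) :
  (forall j, j \in X -> (row j V <= B)%MS) -> (row_space X <= B)%MS.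
Proof. by move=> XB; apply/sumsmx_subP => j /XB; rewrite genmxE. Qed.

Lemma row_spaceS (X Z : {set 'I_n}) : X \subset Z -> (row_space X <= row_space Z)%MS.
Proof. by move=> /subsetP XZ; apply: row_space_sub => j /XZ; apply: row_sub_space. Qed.

(* The rows indexed by S are coloops of the matroid of the rows indexed by G,
   so each of them lowers the rank when it is removed. *)
Lemma card_coloops (S G : {set 'I_n}) : S \subset G ->
  (forall j, j \in S -> ~~ (row j V <= row_space (G :\ j))%MS) ->
  (#|S| + \rank (row_space (G :\: S)) <= m)%N.
Proof.
move Ek: #|S| => k; elim: k => [|k IH] in S Ek *.
  by rewrite add0n => _ _; apply: rank_leq_col.
move=> SG coS; have /card_gt0P[j jS] : (0 < #|S|)%N by rewrite Ek.
have Sj : #|S :\ j| = k by move: Ek; rewrite (cardsD1 j) jS => -[].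
apply: (@leq_trans (#|S :\ j| + \rank (row_space (G :\: (S :\ j))))); last first.
  rewrite Sj; apply: IH => // [|i /setD1P[_ /coS] //].
  exact: subset_trans (subD1set _ _) SG.
rewrite Sj addSnnS leq_add2l; apply: rank_ltmx.
rewrite ltmxE row_spaceS; last by apply: setDS; apply: subD1set.
have jGS : j \in G :\: (S :\ j) by rewrite !inE eqxx /= (subsetP SG).
apply: contra (coS j jS) => /(submx_trans (row_sub_space jGS)) /submx_trans; apply.
apply: row_spaceS; apply/subsetP=> i; rewrite !inE => /andP[iS ->]; rewrite andbT.
by apply: contraNneq iS => ->.
Qed.

End RowSpace.

(** * Factorization of the matrix and the bound on irredundant sets *)

Lemma Smith_factor m n (A : 'M[int]_(m, n)) : (m <= n)%N ->
  exists (B : 'M[int]_m) (Y : 'M[int]_(m, n)) (Z : 'M[int]_(n, m)),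
    A = B *m Y /\ Y *m Z = 1%:M.
Proof.
move=> le_mn; have [L uL [R uR [d _ ->]]] := int_Smith_normal_form A.
(* [Y] consists of the first [m] rows of the unimodular [R], which gives the right inverse; the
   invariant factors all go into [B]. *)
exists (L *m diag_mx (\row_i d`_i)), (pid_mx m *m R), (invmx R *m pid_mx m); split.
  rewrite !mulmxA; congr (_ *m _); rewrite -mulmxA; congr (_ *m _); apply/matrixP=> i j.
  by rewrite mul_diag_mx !mxE ltn_ord andbT mulr_natr.
by rewrite mulmxA mulmxK // pid_mx_id // pid_mx_1.
Qed.

(** A prime dividing all the maximal minors would make the rank drop modulo that prime, which a
    right inverse forbids. *)
Lemma coprime_gcd_minors m n (Y : 'M[int]_(m, n)) (Z : 'M[int]_(n, m)) :
  Y *m Z = 1%:M -> gcd_minors Y = 1%N.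
Proof.
move=> YZ; apply/eqP/negPn/negP => gY1.
have [p p_pr pg] : exists2 p, prime p & (p %| gcd_minors Y)%N.
  have [->|g0] := eqVneq (gcd_minors Y) 0%N; first by exists 2.
  by exists (pdiv (gcd_minors Y)); rewrite ?pdiv_dvd ?pdiv_prime //; lia.
pose f := (intr : int -> 'F_p).
have fullY : row_full (map_mx f Y)^T.
  apply/row_fullP; exists (map_mx f Z)^T.
  by rewrite -trmx_mul -map_mxM YZ map_mx1 trmx1.
have := fullrowsub_unit fullY; rewrite unitmxE unitfE.
set h := fullrankfun _; have := dvdn_trans pg (gcd_minors_dvd Y h).
rewrite -Fp_eq0 // => /eqP detY; rewrite -det_tr (_ : _^T = map_mx f (colsub h Y)).
  by rewrite det_map_mx /f /= detY eqxx.
by apply/matrixP=> i j; rewrite !mxE.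
Qed.

Lemma gcd_minors_mul m n (B : 'M[int]_m) (Y : 'M[int]_(m, n)) :
  gcd_minors (B *m Y) = (`|\det B| * gcd_minors Y)%N.
Proof.
have bigM := big_morph (muln `|\det B|) (fun x y => muln_gcdr _ x y) (muln0 _).
rewrite /gcd_minors bigM; apply: eq_bigr => g /eqP gm.
by have [f [_ _ _ fE]] := minor_colsub gm; rewrite !fE -mulmx_colsub det_mulmx abszM.
Qed.

(** The columns of [tau] account for the summand [m]; every other column is charged to a prime
    modulo which it is a coloop, and [cardS] limits the charge of each prime. *)
Lemma irredundant_bound m n (A : 'M[int]_(m, n)) (tau gamma : {set 'I_n}) :
  #|tau| = m -> minor A tau != 0 -> tau \subset gamma ->
  (forall v, lattice A v -> span_on A gamma v) ->
  (forall j, j \in gamma :\: tau -> ~ span_on A (gamma :\ j) (col j A)) ->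
  (#|gamma| <= m + trunc_Omega m (`|minor A tau| %/ gcd_minors A))%N.
Proof.
move=> tau_m minor0 tauG spanG irr.
have le_mn : (m <= n)%N by rewrite -tau_m -[n in (_ <= n)%N]card_ord max_card.
have [B [Y [Z [defA YZ]]]] := Smith_factor A le_mn.
have [h [h_inj h_tau _ hdet]] := minor_colsub tau_m.
have detA : minor A tau = \det B * minor Y tau.
  by rewrite !hdet defA -mulmx_colsub det_mulmx.
have [detB detY] : \det B != 0 /\ minor Y tau != 0.
  by apply/andP; rewrite -negb_or -mulf_eq0 -detA.
(* [B] is cancelled over the integers through its adjugate. *)
have Binj l (X X' : 'M[int]_(m, l)) : B *m X = B *m X' -> X = X'.
  move=> /(congr1 (mulmx (\adj B))); rewrite !mulmxA mul_adj_mx !mul_scalar_mx.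
  move=> /matrixP eqX; apply/matrixP=> i k; apply: (mulfI detB).
  by have := eqX i k; rewrite !mxE.
set z := (_ %/ _)%N; have {z}-> : z = `|minor Y tau|%N.
  rewrite /z detA defA gcd_minors_mul (coprime_gcd_minors YZ) muln1 abszM.
  by rewrite mulKn // absz_gt0.
set z := `|_|%N; have z_gt0 : (0 < z)%N by rewrite absz_gt0.
pose Yp p := map_mx (intr : int -> 'F_p) Y^T.
pose S p := [set j in gamma :\: tau | ~~ (row j (Yp p) <= row_space (Yp p) (gamma :\ j))%MS].
pose rk p := \rank (map_mx (intr : int -> 'F_p) (colsub h Y)).
have rk_tau p : (rk p <= \rank (row_space (Yp p) tau))%N.
  rewrite /rk -mxrank_tr; apply: mxrankS; apply/row_subP=> i.
  rewrite (_ : row i _ = row (h i) (Yp p)) ?row_sub_space //.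
  by apply/rowP=> k; rewrite !mxE.
have cardS p : prime p -> (#|S p| <= minn (logn p z) m)%N.
  move=> p_pr; have Srk : (#|S p| + rk p <= m)%N.
    apply: leq_trans (card_coloops (V := Yp p) (S := S p) (G := gamma) _ _).
    - rewrite leq_add2l (leq_trans (rk_tau p)) // mxrankS // row_spaceS //.
      by apply/subsetP=> j jt; rewrite !inE jt (subsetP tauG).
    - by apply/subsetP=> j; rewrite !inE => /andP[/andP[]].
    - by move=> j; rewrite !inE => /andP[].
  rewrite leq_min (leq_trans (leq_addr _ _) Srk) andbT.
  rewrite -pfactor_dvdn //; apply: dvdn_trans (dvdn_exp2l p _) _; last first.
    by rewrite /z hdet; apply: pexp_corank_dvd_det.
  by rewrite leq_subRL ?rank_leq_row // addnC.
(* As [Y] is right invertible, the columns of [B] lie in the lattice of [A], hence in that of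
   [gamma]. Cancelling [B] leaves a right inverse of [Y] supported on [gamma]. *)
have [X X0 YX] : exists2 X : 'M[int]_(n, m),
    forall j, j \notin gamma -> row j X = 0 & Y *m X = 1%:M.
  have /fin_all_exists2[x x0 xE] (i : 'I_m) : exists2 x : 'cV_n,
      (forall j, j \notin gamma -> x j 0 = 0) & col i B = A *m x.
    by apply: spanG; exists (col i Z); rewrite !colE mulmxA defA -(mulmxA B) YZ mulmx1.
  exists (\matrix_(j, i) x i j 0) => [j jg|]; first by apply/rowP=> i; rewrite !mxE x0.
  apply: Binj; rewrite mulmxA -defA mulmx1; apply/matrixP=> i k.
  by move/colP/(_ i): (xE k); rewrite !mxE => ->; apply: eq_bigr => j _; rewrite mxE.
have coverS j : j \in gamma :\: tau -> exists2 p, p \in primes z & j \in S p.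
  move=> jgt; apply/hasP; apply: contra_notT (irr j jgt) => /hasPn noS.
  have [jt jg] : j \notin tau /\ j \in gamma by move: jgt; rewrite inE => /andP.
  (* [M] zeroes the columns outside [gamma :\ j] without changing the format. It remains to see that
     the masked [Y] has rank [m] modulo every prime. *)
  pose M : 'M[int]_n := diag_mx (\row_k (k \in gamma :\ j)%:R).
  have [N NM NE] : exists2 N : 'M[int]_(m, n), N = Y *m M &
      forall i k, N i k = Y i k * (k \in gamma :\ j)%:R.
    by exists (Y *m M) => // i k; rewrite mul_mx_diag !mxE.
  have [p p_pr|y yE] := lattice_full (N := N) _ (col j Y).
    apply/eqP; rewrite -mxrank_tr -[_ == _]/(row_full _) -sub1mx.
    have /submx_trans-> // : (1%:M <= row_space (Yp p) (gamma :\ j))%MS; last first.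
      apply: row_space_sub => k kgj.
      suff -> : row k (Yp p) = row k (map_mx intr N)^T by apply: row_sub.
      by apply/rowP=> i; rewrite !mxE NE kgj mulr1.
    (* If [p] does not divide [z], the columns of [tau] are already independent modulo [p].
       Otherwise column [j] depends on the others modulo [p], which therefore span as much as
       [gamma], that is, everything. *)
    have [pz|pz] := boolP (p \in primes z); last first.
      rewrite sub1mx /row_full eqn_leq rank_leq_col /=.
      apply: (@leq_trans (rk p)).
        rewrite /rk; suff /mxrank_unit-> : map_mx (intr : int -> 'F_p) (colsub h Y) \in unitmx by [].
        rewrite unitmxE unitfE det_map_mx Fp_eq0 // -hdet.
        by apply: contra pz => pz; rewrite mem_primes p_pr z_gt0.
      apply: leq_trans (rk_tau p) _; apply: mxrankS; apply: row_spaceS.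
      by apply/subsetP=> k kt; rewrite !inE (subsetP tauG) // andbT; apply: contraNneq jt => <-.
    apply: (@submx_trans _ _ _ _ _ _ (row_space (Yp p) gamma)); last first.
      apply: row_space_sub => k kg; have [->|kj] := eqVneq k j.
        by move: (noS p pz); rewrite inE jgt negbK.
      by apply: row_sub_space; rewrite !inE kj.
    have -> : 1%:M = (map_mx (intr : int -> 'F_p) X)^T *m Yp p.
      by rewrite /Yp -map_trmx -trmx_mul -map_mxM YX map_mx1 trmx1.
    apply/row_subP=> i; rewrite row_mul mulmx_sum_row; apply: summx_sub => k _.
    have [kg|/X0/rowP/(_ i) Xk0] := boolP (k \in gamma).
      by apply: scalemx_sub; apply: row_sub_space.
    by move: Xk0; rewrite !mxE => ->; rewrite scale0r sub0mx.
  exists (M *m y) => [k /negPf kg|].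
    by rewrite mul_diag_mx !mxE kg mul0r.
  by rewrite defA colE -(mulmxA B) -colE yE NM -!mulmxA.
rewrite -(cardsID tau gamma) (setIidPr tauG) tau_m leq_add2l.
(* Double counting of the pairs formed by a column and a prime to which it is charged. *)
apply: (@leq_trans (\sum_(j in gamma :\: tau) \sum_(p <- primes z) (j \in S p))).
  rewrite -sum1_card; apply: leq_sum => j /coverS[p pz jSp].
  by rewrite (big_rem p) //= jSp.
rewrite exchange_big /=; rewrite /trunc_Omega !big_seq; apply: leq_sum => p.
rewrite mem_primes => /andP[/cardS pS _]; apply: leq_trans pS.
rewrite -sum1_card big_mkcond [X in (_ <= X)%N]big_mkcond /=; apply: leq_sum => j _.
by case: (j \in S p); case: ifP.
Qed.

(** * Integer pivoting *)

Section Exchange.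
Variables (R : idomainType) (m : nat).
Implicit Types (M : 'M[R]_m) (a : 'cV[R]_m).

Definition exchange M j a : 'M[R]_m := \matrix_(r, s) if s == j then a r 0 else M r s.

Lemma col_exchange M j a s : col s (exchange M j a) = if s == j then a else col s M.
Proof. by apply/colP=> r; rewrite !mxE; case: eqP => // _; rewrite mxE. Qed.

Lemma cofactor_exchange M j a r : cofactor (exchange M j a) r j = cofactor M r j.
Proof.
rewrite /cofactor; congr (_ * \det _); apply/matrixP=> i s.
by rewrite !mxE eq_sym (negPf (neq_lift _ _)).
Qed.

(** Cramer's rule: a tableau entry is the determinant reached after the corresponding exchange. This
    serves both for the new pivot and for the size bounds. *)
Lemma det_exchange M j a : \det (exchange M j a) = (\adj M *m a) j 0.
Proof.
rewrite (expand_det_col _ j) mxE; apply: eq_bigr => r _.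
by rewrite cofactor_exchange !mxE eqxx mulrC.
Qed.

Lemma adj_exchange_row M j a : row j (\adj (exchange M j a)) = row j (\adj M).
Proof. by apply/rowP=> r; rewrite !mxE cofactor_exchange. Qed.

(* Jordan's step without fractions; both sides agree after multiplication by
   the exchanged matrix. *)
Lemma adj_exchange M j a i : i != j -> \det (exchange M j a) != 0 ->
  \det M *: row i (\adj (exchange M j a)) =
  (\adj M *m a) j 0 *: row i (\adj M) - (\adj M *m a) i 0 *: row j (\adj M).
Proof.
set M' := exchange M j a; set y := \adj M *m a => ij detM'.
suff : (\det M *: row i (\adj M')) *m M' =
       (y j 0 *: row i (\adj M) - y i 0 *: row j (\adj M)) *m M'.
  move=> /(congr1 (mulmx^~ (\adj M'))); rewrite -!mulmxA mul_mx_adj !mul_mx_scalar.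
  by move=> /rowP eqr; apply/rowP=> k; apply: (mulfI detM'); have := eqr k; rewrite !mxE.
rewrite -scalemxAl -row_mul mul_adj_mx det_exchange -/y mulmxBl -!scalemxAl -!row_mul.
apply/rowP=> s; have Mcol r : (\adj M *m M') r s = if s == j then y r 0 else \det M *+ (r == s).
  transitivity ((\adj M *m col s M') r 0).
    by rewrite !mxE; apply: eq_bigr => k _; rewrite !mxE.
  rewrite col_exchange; case: eqP => // _.
  by rewrite colE mulmxA mul_adj_mx -colE !mxE.
move: (\adj M *m M') Mcol => P Mcol; clearbody y; rewrite !mxE !Mcol; have [->|sj] := eqVneq s j.
  by rewrite (negPf ij) mulr0n mulr0 [X in _ - X]mulrC subrr.
by rewrite mulr0n mulr0 subr0 !mulrnAr mulrC.
Qed.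

End Exchange.

Lemma det_bound m (M : 'M[int]_m) X :
  (forall i j, `|M i j| <= X%:Z) -> `|\det M| <= (m`! * X ^ m)%N%:Z.
Proof.
move=> MX; apply: le_trans (ler_norm_sum _ _ _) _.
have -> : (m`! * X ^ m)%N%:Z = \sum_(s : 'S_m) (X ^ m)%N%:Z.
  by rewrite sumr_const card_Sn -mulr_natl natz.
apply: ler_sum => s _; rewrite normrMsign normr_prod.
have -> : (X ^ m)%N%:Z = \prod_(i < m) X%:Z.
  by rewrite prodr_const card_ord -natz natrX natz.
by apply: ler_prod => i _; rewrite normr_ge0 MX.
Qed.

Section Pivot.
Variables (m n : nat) (A : 'M[int]_(m, n)) (tau : {set 'I_n}).

(* T is the tableau adj(M) A, where M is the identity matrix with its first j
   columns replaced by columns of A indexed by tau. The entries of T are thus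
   determinants, by Cramer's rule, and the divisions in [pivot] are exact. *)
Definition pivot_inv (j : nat) (T : 'M[int]_(m, n)) (d : int) :=
  exists M : 'M[int]_m,
    [/\ \det M = d, d != 0, T = \adj M *m A,
        forall s : 'I_m, (s < j)%N -> exists2 k, k \in tau & col s M = col k A
      & forall s : 'I_m, (j <= s)%N -> col s M = delta_mx s 0].

Definition pivot (T : 'M[int]_(m, n)) (d : int) (j : 'I_m) (k : 'I_n) : 'M[int]_(m, n) :=
  \matrix_(r, c) if r == j then T r c
                 else ((T j k * T r c - T r k * T j c) %/ d)%Z.

Lemma pivot_inv0 : pivot_inv 0 A 1.
Proof.
exists 1%:M; split; rewrite ?det1 ?adj1 ?mul1mx //.
by move=> s _; apply/colP=> i; rewrite !mxE andbT.
Qed.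

Lemma pivot_inv_step (j : 'I_m) T d k :
  pivot_inv j T d -> k \in tau -> T j k != 0 -> pivot_inv j.+1 (pivot T d j k) (T j k).
Proof.
move=> [M [detM d0 defT Mlt Mge]] ktau Tjk.
have yE r : (\adj M *m col k A) r 0 = T r k.
  by rewrite defT !mxE; apply: eq_bigr => s _; rewrite !mxE.
have detM' : \det (exchange M j (col k A)) = T j k by rewrite det_exchange yE.
exists (exchange M j (col k A)); split=> // [|s|s js].
- apply/matrixP=> r c; rewrite [LHS]mxE; case: eqVneq => [->|rj].
    have -> : T j c = (row j (\adj M) *m A) 0 c by rewrite -row_mul -defT mxE.
    by rewrite -(adj_exchange_row M j (col k A)) -row_mul mxE.
  have /(congr1 (fun u => (u *m A) 0 c)) := adj_exchange rj (etrans (congr1 (fun x => x != 0) detM') Tjk).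
  rewrite mulmxBl -!scalemxAl -!row_mul -defT !yE detM.
  rewrite !mxE => <-; rewrite mulKz //.
- rewrite ltnS leq_eqVlt => /orP[/eqP/val_inj->|sj].
    by exists k; rewrite // col_exchange eqxx.
  rewrite col_exchange ifN; first exact: Mlt.
  by apply: contraTneq sj => ->; rewrite ltnn.
- rewrite col_exchange ifN; first by apply: Mge; apply: ltnW.
  by apply: contraTneq js => ->; rewrite ltnn.
Qed.

(** A zero row over [tau] would make [\adj M *m A_tau] singular. A column used earlier cannot be
    chosen again: it has become [d] times a unit vector supported above row [j]. *)
Lemma pivot_inv_exists (j : 'I_m) T d :
  #|tau| = m -> minor A tau != 0 -> pivot_inv j T d ->
  exists2 k, k \in tau & T j k != 0.
Proof.
move=> tau_m; have [h [_ htau _ ->]] := minor_colsub tau_m => detA [M [detM d0 defT _ _]].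
apply/exists_inP; apply: contraNT (mulf_neq0 d0 (mulf_neq0 detA d0)).
rewrite negb_exists_in => /forall_inP Tj0.
have : \det (\adj M *m colsub h A) = 0.
  rewrite mulmx_colsub -defT (expand_det_row _ j) big1 // => s _.
  by rewrite mxE (eqP (negPn (Tj0 _ (htau s)))) mul0r.
move=> /(congr1 ( *%R (\det M))); rewrite mulr0 -det_mulmx mulmxA mul_mx_adj.
by rewrite mul_scalar_mx detZ detM => /eqP; rewrite !mulf_eq0 expf_eq0 (negPf d0) (negPf detA) andbF.
Qed.

Lemma pivot_inv_bound j T d X :
  (0 < X)%N -> (forall r c, `|A r c| <= X%:Z) -> pivot_inv j T d ->
  [/\ `|d| <= (m`! * X ^ m)%N%:Z & forall r c, `|T r c| <= (m`! * X ^ m)%N%:Z].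
Proof.
move=> X0 AX [M [detM d0 defT Mlt Mge]].
have MX r s : `|M r s| <= X%:Z.
  have -> : M r s = col s M r 0 by rewrite mxE.
  have [/Mlt[k _ ->]|/Mge->] := ltnP s j; first by rewrite mxE.
  by rewrite mxE andbT; case: (r == s); lia.
split=> [|r c]; first by rewrite -detM; apply: det_bound.
have -> : T r c = (\adj M *m col c A) r 0.
  by rewrite defT !mxE; apply: eq_bigr => s _; rewrite !mxE.
rewrite -det_exchange; apply: det_bound => i s; rewrite mxE; case: eqP => // _.
by rewrite mxE.
Qed.

(** Up to the scalar [d], [M] and its adjugate are inverse to each other, so relations between
    columns are the same in [A] and in [T]. The sign of [d] is still arbitrary. *)
Lemma pivot_invE T d : pivot_inv m T d ->
  [/\ d != 0, forall i, exists2 k, k \in tau & col k T = d *: delta_mx i 0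
    & forall g j, span_on A g (col j A) <-> span_on T g (col j T)].
Proof.
move=> [M [detM d0 defT Mlt _]]; split=> // [i|g j].
  have [k kt Mk] := Mlt i (ltn_ord i); exists k => //.
  by rewrite colE defT -mulmxA -colE -Mk colE mulmxA mul_adj_mx detM mul_scalar_mx.
split=> -[x x0 xE]; exists x => //.
  by rewrite defT -mulmxA -xE !colE mulmxA.
move: xE; rewrite defT colE -!mulmxA -colE => /(congr1 (mulmx M)).
rewrite !mulmxA mul_mx_adj detM -!mulmxA !mul_scalar_mx => /colP eqx.
by apply/colP=> r; apply: (mulfI d0); have := eqx r; rewrite !mxE.
Qed.

End Pivot.

(** * Insertion of a vector into a triangular basis *)

Section Insertion.
Variables (m : nat) (d : int).
Hypothesis d_gt0 : 0 < d.
Implicit Types (H : 'M[int]_m) (v x : 'cV[int]_m).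

Definition triangular H :=
  [/\ forall r s : 'I_m, (r < s)%N -> H r s = 0, forall s, 0 < H s s
    & forall r s, 0 <= H r s <= d].

(** Weaker than the Hermite normal form: off-diagonal entries are merely bounded by [d]. Containing
    all [d e_r] is what allows reduction modulo [d]. *)
Definition hermite H :=
  triangular H /\ forall r, lattice H (d *: delta_mx r 0).

(** The lattice generated by [v] and the columns of [H]. *)
Definition lattice_with H v x := exists t : int, lattice H (x - t *: v).

Lemma latticeD n (M : 'M[int]_(m, n)) x y :
  lattice M x -> lattice M y -> lattice M (x + y).
Proof. by move=> [c ->] [c' ->]; exists (c + c'); rewrite mulmxDr. Qed.

Lemma latticeZ n (M : 'M[int]_(m, n)) t x : lattice M x -> lattice M (t *: x).
Proof. by move=> [c ->]; exists (t *: c); rewrite scalemxAr. Qed.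

Lemma latticeB n (M : 'M[int]_(m, n)) x y :
  lattice M x -> lattice M y -> lattice M (x - y).
Proof. by move=> Mx My; rewrite -scaleN1r; apply: latticeD => //; apply: latticeZ. Qed.

Lemma lattice0 n (M : 'M[int]_(m, n)) : lattice M 0.
Proof. by exists 0; rewrite mulmx0. Qed.

Lemma lattice_col n (M : 'M[int]_(m, n)) i : lattice M (col i M).
Proof. by exists (delta_mx i 0); rewrite colE. Qed.

Lemma lattice_sum n (M : 'M[int]_(m, n)) (I : finType) (P : pred I) (F : I -> 'cV[int]_m) :
  (forall i, P i -> lattice M (F i)) -> lattice M (\sum_(i | P i) F i).
Proof. by move=> MF; apply: big_ind => //; [apply: lattice0 | apply: latticeD]. Qed.

Lemma mulmx_cols n (M : 'M[int]_(m, n)) (c : 'cV[int]_n) :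
  M *m c = \sum_s c s 0 *: col s M.
Proof.
by apply/colP=> r; rewrite mxE summxE; apply: eq_bigr => s _; rewrite !mxE mulrC.
Qed.

Lemma triangular_support H (c : 'cV[int]_m) (i : nat) :
  triangular H -> (forall r : 'I_m, (r < i)%N -> (H *m c) r 0 = 0) ->
  forall s : 'I_m, (s < i)%N -> c s 0 = 0.
Proof.
move=> [tri diag _] Hc0 s; have [k] := ubnP (s : nat); elim: k s => // k IH s sk si.
have := Hc0 s si; rewrite mxE (bigD1 s) //= big1 => [|r rs].
  by rewrite addr0 => /eqP; rewrite mulf_eq0 gt_eqF //= => /eqP.
have [lt_rs|] := ltnP r s; first by rewrite IH ?mulr0 //; lia.
by rewrite leq_eqVlt eq_sym val_eqE (negPf rs) /= => /tri ->; rewrite mul0r.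
Qed.

Lemma triangular_dvd H v (i : 'I_m) : triangular H -> lattice H v ->
  (forall r : 'I_m, (r < i)%N -> v r 0 = 0) -> (H i i %| (v i 0)%R)%Z.
Proof.
move=> triH [c ->] Hc0; have c0 := triangular_support triH Hc0.
rewrite mxE (bigD1 i) //= big1 => [|s si]; first by rewrite addr0 dvdz_mulr.
have [/c0->|] := ltnP s i; first by rewrite mulr0.
rewrite leq_eqVlt eq_sym val_eqE (negPf si) /= => lt_is.
by case: triH => -> //; rewrite mul0r.
Qed.

(** By forward substitution the coefficients of [d e_r] vanish before index [r], so column [i] does
    not take part in the combination. *)
Lemma lattice_exchange_gt H (i r : 'I_m) v : triangular H -> (i < r)%N ->
  lattice H (d *: delta_mx r 0) -> lattice (exchange H i v) (d *: delta_mx r 0).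
Proof.
move=> triH ir [c cE]; exists c; rewrite cE !mulmx_cols; apply: eq_bigr => s _.
rewrite col_exchange; case: eqP => // ->.
rewrite (triangular_support (i := r) triH) ?scale0r // => t tr.
by rewrite -cE !mxE andbT -val_eqE ltn_eqF ?mulr0.
Qed.

(* State reached when the vector v0, inserted into the basis H0, has been
   cleared up to row i. The flag records whether Euclid's algorithm has ever
   left a nonzero remainder, i.e. whether v0 fails to belong to the lattice. *)
Definition insertion (H0 : 'M[int]_m) (v0 : 'cV[int]_m) (i : nat) H v (flag : bool) :=
  [/\ triangular H,
      (forall r, 0 <= v r 0 <= d) /\ (forall r : 'I_m, (r < i)%N -> v r 0 = 0),
      forall r : 'I_m, (i < r)%N -> lattice H (d *: delta_mx r 0),
      forall x, lattice_with H v x <-> lattice_with H0 v0 x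
    & (~~ flag -> H = H0 /\ lattice H0 (v0 - v)) /\ (lattice H0 v0 -> ~~ flag)].

Lemma insertion0 H0 v0 : hermite H0 -> (forall r, 0 <= v0 r 0 <= d) ->
  insertion H0 v0 0 H0 v0 false.
Proof.
move=> [triH0 latH0] v0d; split=> //; split=> // _; split=> //.
by rewrite subrr; apply: lattice0.
Qed.

Lemma insertionS H0 v0 (i : 'I_m) H v flag :
  insertion H0 v0 i H v flag -> v i 0 = 0 -> insertion H0 v0 i.+1 H v flag.
Proof.
move=> [triH [vd vlt] latH latE flagP] vi0; split=> //; last by move=> r /ltnW/latH.
split=> // r; rewrite ltnS leq_eqVlt => /orP[/eqP/val_inj->//|]; exact: vlt.
Qed.

Lemma insertion_end H0 v0 H v flag : hermite H0 ->
  insertion H0 v0 m H v flag ->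
  [/\ hermite H, forall x, lattice H x <-> lattice_with H0 v0 x
    & ~~ flag <-> lattice H0 v0].
Proof.
move=> [triH0 latH0] [triH [_ vlt] latH latE [flag1 flag2]].
have {vlt} v0E : v = 0 by apply/colP=> r; rewrite vlt ?mxE.
have latHE x : lattice H x <-> lattice_with H0 v0 x.
  rewrite -latE v0E; split=> [Hx|[t]]; last by rewrite scaler0 subr0.
  by exists 0; rewrite scaler0 subr0.
split=> //; first split=> // r.
  by apply/latHE; exists 0; rewrite scale0r subr0; apply: latH0.
by split=> [/flag1[_]|/flag2 //]; rewrite v0E subr0.
Qed.

(** The reduction modulo [d] is written uniformly but acts only below row [i]: during an insertion,
    earlier rows are 0 and row [i] holds a remainder smaller than [H i i], itself at most [d]. *)
Definition reduce H v (i : 'I_m) : 'cV[int]_m :=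
  \col_r (((v r 0)%R - ((v i 0)%R %/ H i i)%Z * H r i)%R %% d)%Z.

Lemma reduce_pivot H0 v0 (i : 'I_m) H v flag : insertion H0 v0 i H v flag ->
  reduce H v i i 0 = ((v i 0)%R %% H i i)%Z.
Proof.
move=> [[_ diag Hd] _ _ _ _]; rewrite mxE; apply: modz_small.
rewrite -[_ - _]/(modz _ _) modz_ge0 ?gt_eqF //=.
by have := ltz_mod (v i 0) (lt0r_neq0 (diag i)); have := diag i; have := Hd i i; lia.
Qed.

(** The correction [u] combines the [d e_r] with [r > i] only; it thus belongs to the lattice before
    and after column [i] is replaced, as both inclusions in [insertion_swap] require. *)
Lemma reduceE H0 v0 (i : 'I_m) H v flag : insertion H0 v0 i H v flag ->
  exists u, [/\ reduce H v i = v - ((v i 0)%R %/ H i i)%Z *: col i H - u, lattice H u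
    & forall a, lattice (exchange H i a) u].
Proof.
move=> ins; have [triH [vd vlt] latH _ _] := ins; set q := (_ %/ _)%Z.
pose w r := ((v r 0 - q * H r i)%R %/ d)%Z.
exists (\sum_(r < m | (i < r)%N) w r *: (d *: delta_mx r 0)); split.
- apply/colP=> r; rewrite !mxE summxE; set x := v r 0 - _; set z := \sum_(_ | _) _.
  suff -> : z = (x %/ d)%Z * d by rewrite /modz.
  have [ri|ir] := leqP r i.
    have : (x %% d)%Z = x.
      rewrite /x; move: ri; rewrite leq_eqVlt => /orP[/eqP/val_inj->|lt_ri].
        have := reduce_pivot ins; rewrite mxE -/q => ->.
        by rewrite {2}(divz_eq (v i 0) (H i i)) -/q addrAC subrr add0r.
      by have [tri _ _] := triH; rewrite (vlt _ lt_ri) (tri _ _ lt_ri) mulr0 subrr mod0z.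
    move=> xd; have -> : (x %/ d)%Z * d = 0.
      by apply: (addIr x); rewrite add0r -{2}xd -divz_eq.
    rewrite /z big1 // => t it; rewrite !mxE andbT.
    by rewrite -val_eqE ltn_eqF ?mulr0 // (leq_ltn_trans ri).
  rewrite /z (bigD1 r) //= big1 => [|t /andP[_ tr]].
    by rewrite !mxE !eqxx mulr1 addr0.
  by rewrite !mxE eq_sym (negPf tr) !mulr0.
- by apply: lattice_sum => r ir; apply: latticeZ; apply: latH.
- move=> a; apply: lattice_sum => r ir; apply: latticeZ.
  by apply: lattice_exchange_gt => //; apply: latH.
Qed.

Lemma reduce_range H v i r : 0 <= reduce H v i r 0 <= d.
Proof. by rewrite mxE modz_ge0 ?gt_eqF //= ltW // ltz_pmod. Qed.

Lemma reduce_lt H0 v0 (i : 'I_m) H v flag (r : 'I_m) :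
  insertion H0 v0 i H v flag -> (r < i)%N -> reduce H v i r 0 = 0.
Proof.
move=> [[tri _ _] [_ vlt] _ _ _] ri.
by rewrite mxE (vlt _ ri) (tri _ _ ri) mulr0 subrr mod0z.
Qed.

Lemma insertion_reduce H0 v0 (i : 'I_m) H v flag :
  insertion H0 v0 i H v flag -> insertion H0 v0 i H (reduce H v i) flag.
Proof.
move=> ins; have [u [vE Hu _]] := reduceE ins.
have [triH [vd vlt] latH latE [flag1 flag2]] := ins; move: vE; set q := (_ %/ _)%Z => vE.
have Hi := lattice_col H i.
split=> //.
- by split=> [r|r ri]; [apply: reduce_range | apply: reduce_lt ins ri].
- move=> x; rewrite -latE; split=> -[t tE]; exists t.
    have -> : x - t *: v = (x - t *: reduce H v i) - t *: (q *: col i H) - t *: u.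
      by rewrite vE; apply/colP=> r; rewrite !mxE; ring.
    by apply: latticeB; [apply: latticeB => //|]; do ?apply: latticeZ.
  have -> : x - t *: reduce H v i = (x - t *: v) + t *: (q *: col i H) + t *: u.
    by rewrite vE; apply/colP=> r; rewrite !mxE; ring.
  by apply: latticeD; [apply: latticeD => //|]; do ?apply: latticeZ.
- split=> // /flag1[HE Hv]; split=> //.
  have -> : v0 - reduce H v i = (v0 - v) + q *: col i H + u by rewrite vE; apply/colP=> r; rewrite !mxE; ring.
  by rewrite -HE in Hv *; apply: latticeD; [apply: latticeD => //|]; do ?apply: latticeZ.
Qed.

Lemma lattice_split (M M' : 'M[int]_m) i y :
  (forall s, s != i -> col s M = col s M') -> lattice M y ->
  exists t, lattice M' (y - t *: col i M).
Proof.
move=> MM' [c ->]; exists (c i 0); rewrite mulmx_cols (bigD1 i) //= addrAC subrr add0r.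
by apply: lattice_sum => s /MM' ->; apply: latticeZ; apply: lattice_col.
Qed.

Lemma insertion_swap H0 v0 (i : 'I_m) H v flag :
  insertion H0 v0 i H v flag -> reduce H v i i 0 != 0 ->
  insertion H0 v0 i (exchange H i (reduce H v i)) (col i H) true.
Proof.
move=> ins rdi; have [u [vE Hu Eu]] := reduceE ins; have rdE := reduce_pivot ins.
have [triH [vd vlt] latH latE [flag1 flag2]] := ins; move: vE; set q := (_ %/ _)%Z => vE.
have [tri diag Hd] := triH; set v' := reduce H v i in rdi vE *; set E := exchange H i v'.
have Hi := lattice_col H i.
have Ei : lattice E v' by have := lattice_col E i; rewrite col_exchange eqxx.
have HE s : s != i -> col s H = col s E by rewrite col_exchange => /negPf->.
split.
- split=> [r s rs|s|r s]; rewrite mxE; case: eqP => [si|_] //.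
  + by rewrite si in rs; apply: reduce_lt ins rs.
  + exact: tri.
  + by rewrite si lt0r rdi; case/andP: (reduce_range H v i i).
  + exact: reduce_range.
- by split=> [r|r ri]; rewrite mxE; [apply: Hd | apply: tri].
- by move=> r ir; apply: lattice_exchange_gt => //; apply: latH.
- move=> x; rewrite -latE; split=> -[t].
    move=> /(lattice_split (i := i) (M' := H))[s si|s]; first by rewrite HE.
    rewrite col_exchange eqxx => Hx; exists s.
    have -> : x - s *: v = (x - t *: col i H - s *: v') + t *: col i H - s *: (q *: col i H) - s *: u.
      by rewrite vE; apply/colP=> r; rewrite !mxE; ring.
    by apply: latticeB; [apply: latticeB; [apply: latticeD|]|] => //; do ?apply: latticeZ.
  move=> /(lattice_split HE)[s Ex]; exists (t * q + s).
  have -> : x - (t * q + s) *: col i H = (x - t *: v - s *: col i H) + t *: v' + t *: u.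
    by rewrite vE; apply/colP=> r; rewrite !mxE; ring.
  have Eu' : lattice E u by apply: Eu.
  by apply: latticeD; [apply: latticeD => //|]; apply: latticeZ.
(* If [v0] were in the lattice, no swap would have occurred so far and [v] would be in it too; its
   leading entry would be divisible by the pivot, against the nonzero remainder. *)
- split=> // latv0; have [HH0 Hv] := flag1 (flag2 latv0).
  have Hv' : lattice H v by rewrite HH0 -[v](subKr v0); apply: latticeB.
  by case/eqP: rdi; rewrite /v' rdE; apply/dvdz_mod0P; apply: triangular_dvd.
Qed.

End Insertion.

(** * Running times of programs *)

Fixpoint esize (e : expr) : nat :=
  match e with
  | Const _ => 1
  | Read _ a => (esize a).+1
  | Bin _ e1 e2 => (esize e1 + esize e2).+1
  end.

Fixpoint small_consts (e : expr) : bool :=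
  match e with
  | Const z => (`|z| <= 2)%N
  | Read _ a => small_consts a
  | Bin _ e1 e2 => small_consts e1 && small_consts e2
  end.

(* Any constant exceeding the sizes of all the expressions of the programs
   below will do. *)
Definition opcost : nat := 2500.

(** An expression has [esize e] nodes, each of bit size at most [K * esize e + 2], which is at most
    [K * (esize e + 2)] for positive [K]. *)
Definition cheap (e : expr) : bool :=
  small_consts e && (esize e * (esize e + 2) <= opcost)%N.

Lemma bitsize_bound z k : (`|z| <= 2 ^ k)%N -> (bitsize z <= k + 2)%N.
Proof.
move=> zk; rewrite /bitsize addn2 !ltnS; apply: up_log_min => //.
by rewrite expnS; have := expn_gt0 2 k; lia.
Qed.

Lemma absz_divz (x y : int) : (`|(x %/ y)%Z| <= `|x|)%N.
Proof.
have [->|y0] := eqVneq y 0; first by rewrite divz0.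
wlog y_gt0 : y y0 / 0 < y.
  move=> IH; have [y_gt0|y_lt0] : 0 < y \/ y < 0 by lia.
    exact: IH.
  by have := IH (- y); rewrite divzN abszN oppr_eq0 oppr_gt0; apply.
have := divz_eq x y; have := modz_ge0 x y0; have := ltz_pmod x y_gt0.
move: (x %/ y)%Z (x %% y)%Z => q r; have [x0|x0] := lerP 0 x => ry r0 xE.
  have q0 : 0 <= q by nia.
  have qx : q <= x by nia.
  by lia.
have q0 : q < 0 by nia.
have qx : x <= q by nia.
by lia.
Qed.

(** * Program logic with time bounds *)

Section Runs.
Variable K : nat.
Hypothesis K_gt0 : (0 < K)%N.
Implicit Types (s : memory) (c : cmd) (e : expr) (Q : memory -> Prop) (T : nat).

Definition small (z : int) := (`|z| <= 2 ^ K)%N.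

Definition small_memory s := forall b a, small (s b a).

Lemma eval_bound s e : small_memory s -> small_consts e ->
  (`|eval s e| <= 2 ^ (K * esize e))%N.
Proof.
have le2 k l : (k <= l)%N -> (2 ^ k <= 2 ^ l)%N by move=> kl; rewrite leq_exp2l.
move=> ok; elim: e => [z|b a _|o e1 IH1 e2 IH2] /=.
- by move=> z2; rewrite muln1 (leq_trans z2) // -{1}[2%N]expn1 le2.
- by move=> _; apply: leq_trans (ok _ _) _; apply: le2; rewrite leq_pmulr.
move=> /andP[/IH1 le1 /IH2 {IH1 IH2}le_2].
have E1 := expn_gt0 2 (K * esize e1); have E2 := expn_gt0 2 (K * esize e2).
(* The sum of two positive bounds is at most twice their product; the factor 2 is absorbed by the
   last [K], the node's own contribution to [esize]. *)
have : (`|eval s e1| + `|eval s e2| <= 2 ^ (K * esize e1 + K * esize e2 + K))%N.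
  rewrite !expnD; apply: leq_trans (leq_add le1 le_2) _.
  apply: (@leq_trans (2 ^ (K * esize e1) * 2 ^ (K * esize e2) * 2)).
    by move: E1 E2; nia.
  by rewrite leq_mul // -{1}[2%N]expn1 le2.
have eK : (K * (esize e1 + esize e2).+1 = K * esize e1 + K * esize e2 + K)%N by lia.
rewrite eK; case: o => /= le12.
- by apply: leq_trans le12; lia.
- by apply: leq_trans le12; lia.
- by rewrite abszM; apply: leq_trans (leq_mul le1 le_2) _; rewrite -expnD le2 // leq_addr.
- by apply: leq_trans (absz_divz _ _) _; apply: leq_trans le12; rewrite leq_addr.
- by case: ifP => _ /=; rewrite ?expn_gt0.
Qed.

Lemma eval_cost_bound s e : small_memory s -> cheap e -> (eval_cost s e <= opcost * K)%N.
Proof.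
move=> ok /andP[se le_e]; apply: leq_trans (leq_mul le_e (leqnn K)) => {le_e}.
apply: (@leq_trans (esize e * (K * esize e + 2))); last by nia.
elim: e se => [z|b a IH|o e1 IH1 e2 IH2] se /=.
- by have := bitsize_bound (eval_bound ok se); rewrite /=; lia.
- have /= := bitsize_bound (eval_bound ok se); have := IH se; by nia.
- have /= := bitsize_bound (eval_bound ok se); case/andP: se => /IH1 + /IH2.
  by set x := esize e1; set y := esize e2; nia.
Qed.

(* K bounds the bit sizes of the cells; time is counted in units of K. *)
Definition runs c T s Q :=
  exists s' t, [/\ exec c s s' t, (t <= T * K)%N, small_memory s' & Q s'].

Lemma runs_weaken c T T' s Q Q' : runs c T s Q -> (T <= T')%N ->
  (forall s', small_memory s' -> Q s' -> Q' s') -> runs c T' s Q'.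
Proof.
move=> [s' [t [ex tT ok Qs]]] TT' QQ'; exists s', t; split=> //; last exact: QQ'.
by apply: leq_trans tT _; rewrite leq_mul2r TT' orbT.
Qed.

Lemma runs_skip s Q : small_memory s -> Q s -> runs Skip 1 s Q.
Proof. by move=> ok Qs; exists s, 1%N; split=> //; [constructor | rewrite mul1n]. Qed.

Lemma runs_write b a e s Q : small_memory s -> cheap a -> cheap e ->
  small (eval s e) -> Q (update s b (eval s a) (eval s e)) ->
  runs (Write b a e) (2 * opcost) s Q.
Proof.
move=> ok ca ce ve Qs; exists (update s b (eval s a) (eval s e)), (eval_cost s a + eval_cost s e)%N.
split=> //; first by constructor.
  by rewrite mul2n -addnn mulnDl leq_add // eval_cost_bound.
by move=> b' a'; rewrite /update; case: ifP.
Qed.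

(** The second run sits in the postcondition of the first, so that proofs follow the control
    flow. *)
Lemma runs_seq c1 c2 T1 T2 s Q :
  runs c1 T1 s (fun s1 => small_memory s1 -> runs c2 T2 s1 Q) ->
  runs (Seq c1 c2) (T1 + T2) s Q.
Proof.
move=> [s1 [t1 [ex1 le1 ok1 /(_ ok1)[s2 [t2 [ex2 le2 ok2 Qs]]]]]].
exists s2, (t1 + t2)%N; split=> //; first exact: exec_seq ex1 ex2.
by rewrite mulnDl leq_add.
Qed.

Lemma runs_if e c1 c2 T s Q : small_memory s -> cheap e ->
  (eval s e != 0 -> runs c1 T s Q) -> (eval s e = 0 -> runs c2 T s Q) ->
  runs (If e c1 c2) (opcost + T) s Q.
Proof.
move=> ok ce r1 r2.
have [s' [t [ex le ok' Qs]]] : runs (if eval s e != 0 then c1 else c2) T s Q.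
  by have [/r2|/r1] := eqVneq (eval s e) 0.
exists s', (eval_cost s e + t)%N; split=> //; first exact: exec_if ex.
by rewrite mulnDl leq_add // eval_cost_bound.
Qed.

Lemma runs_while e c T (I : memory -> Prop) (mu : memory -> nat) Q : cheap e ->
  (forall s, small_memory s -> I s -> eval s e != 0 ->
     runs c T s (fun s' => I s' /\ (mu s' < mu s)%N)) ->
  (forall s, small_memory s -> I s -> eval s e = 0 -> Q s) ->
  forall N s, small_memory s -> I s -> (mu s <= N)%N ->
  runs (While e c) (N * (opcost + T) + opcost) s Q.
Proof.
move=> ce step stop; elim=> [|N IH] s ok Is muN.
all: have [e0|e0] := eqVneq (eval s e) 0.
1,3: exists s, (eval_cost s e); split=> //; [exact: exec_while_stop | | exact: stop].
1,2: by apply: leq_trans (eval_cost_bound ok ce) _; rewrite leq_mul2r leq_addl orbT.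
  by have [s' [t [_ _ _ [_]]]] := step s ok Is e0; rewrite ltnNge (leq_trans muN).
have [s1 [t1 [ex1 le1 ok1 [I1 mu1]]]] := step s ok Is e0.
have [|s2 [t2 [ex2 le2 ok2 Q2]]] := IH s1 ok1 I1.
  by rewrite -ltnS (leq_trans mu1).
exists s2, (eval_cost s e + t1 + t2)%N; split=> //; first exact: exec_while_step ex1 ex2.
by have := eval_cost_bound ok ce; nia.
Qed.

Definition var (v : nat) : expr := Read v (Const 0).

Definition For (v : nat) (hi : expr) (c : cmd) : cmd :=
  Seq (Write v (Const 0) (Const 0))
      (While (Bin OpLeq (Bin OpAdd (var v) (Const 1)) hi)
             (Seq c (Write v (Const 0) (Bin OpAdd (var v) (Const 1))))).

Definition for_time (W T : nat) : nat :=
  (2 * opcost + (W * (opcost + (T + 2 * opcost)) + opcost))%N.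

(** The loop bound is read again at every test, so the invariant must determine it; the invariant
    must also ignore the counter, which the loop itself writes. The time depends on [W] instead of
    [N], so that one parameter governs all loops. *)
Lemma runs_for v a c (N W T : nat) (I : nat -> memory -> Prop) s Q :
  (`|a| <= 2)%N -> (N <= W)%N -> small N ->
  (forall k s, I k s -> s 0%N a = N) ->
  (forall k s z, I k s -> I k (update s v 0 z)) ->
  small_memory s -> I 0%N s ->
  (forall (k : 'I_N) s', small_memory s' -> s' v 0 = k -> I k s' ->
     runs c T s' (fun s'' => s'' v 0 = k /\ I k.+1 s'')) ->
  (forall s', small_memory s' -> I N s' -> Q s') ->
  runs (For v (Read 0 (Const a)) c) (for_time W T) s Q.
Proof.
move=> a2 NW N_small hiE Iupd ok I0 step stop.
have cheap_hi : small_consts (Read 0 (Const a)) by [].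
have upd s1 z : update s1 v 0 z v 0 = z by rewrite /update !eqxx.
apply: runs_seq; apply: runs_write => //.
move=> ok1; pose J s1 := exists2 k : nat, s1 v 0 = k & (k <= N)%N /\ I k s1.
apply: (@runs_weaken _ (N * (opcost + (T + 2 * opcost)) + opcost) _ _ Q) => //; last first.
  by rewrite leq_add2r leq_mul2r NW orbT.
apply: (runs_while (I := J) (mu := fun s1 => (N - `|s1 v 0%R|)%N)).
- by rewrite /cheap /= a2.
- move=> s1 ok' [k vk [kN Ik]] /=; rewrite (hiE _ _ Ik) vk.
  case: ifP => // kN1 _; have {kN1}ltkN : (k < N)%N by lia.
  apply: runs_seq; apply: runs_weaken (step (Ordinal ltkN) _ ok' vk Ik) _ _ => //.
  move=> s2 ok2 [/= vk2 Ik2] _; apply: runs_write => //=; rewrite vk2.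
    by rewrite /small in N_small *; lia.
  rewrite upd; split; last by lia.
  by exists k.+1; [rewrite upd; lia | split=> //; apply: Iupd].
- move=> s1 ok' [k vk [kN Ik]] /=; rewrite (hiE _ _ Ik) vk.
  case: ifP => // kN1 _; apply: stop => //.
  by have <- : k = N by lia.
- by [].
- by exists 0%N; [rewrite upd | split=> //; apply: Iupd].
- by rewrite upd leq_subr.
Qed.

Definition same_off (bs : seq nat) (s s' : memory) := forall b, b \notin bs -> s' b =1 s b.

(** The body may assume that cells not yet written keep their original contents, which permits
    updates in place. When bank 0 is filled, the loop bound must not be among the cells written. *)
Lemma runs_fill v a b ea e (N W : nat) (f g : 'I_N -> int) s Q :
  (`|a| <= 2)%N -> (N <= W)%N -> small N -> s 0%N a = N -> injective f ->
  v != 0%N -> v != b -> (b = 0%N -> forall k, f k != a) -> cheap ea -> cheap e ->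
  small_memory s ->
  (forall (k : 'I_N) s', small_memory s' -> s' v 0 = k -> same_off [:: v; b] s s' ->
     (forall z, (forall l : 'I_N, (l < k)%N -> z != f l) -> s' b z = s b z) ->
     [/\ eval s' ea = f k, eval s' e = g k & small (g k)]) ->
  (forall s', small_memory s' -> same_off [:: v; b] s s' ->
     (forall k, s' b (f k) = g k) ->
     (forall z, (forall k, z != f k) -> s' b z = s b z) -> Q s') ->
  runs (For v (Read 0 (Const a)) (Write b ea e)) (for_time W (2 * opcost)) s Q.
Proof.
move=> a2 NW N_small sa f_inj v0 vb bf cea ce ok body stop.
pose I (k : nat) s' := [/\ same_off [:: v; b] s s',
   forall l : 'I_N, (l < k)%N -> s' b (f l) = g l
   & forall z, (forall l : 'I_N, (l < k)%N -> z != f l) -> s' b z = s b z].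
apply: (runs_for (N := N) (I := I)) => //.
- move=> k s' [same _ other]; rewrite -sa; have [b0|b0] := eqVneq b 0%N.
    by rewrite -b0 other // => l _; rewrite eq_sym bf.
  by apply: same; rewrite !inE !(eq_sym 0%N) negb_or v0.
- move=> k s' z [same fg other]; split.
  + move=> b' b'n a'; rewrite /update; move: (b'n); rewrite !inE negb_or => /andP[/negPf-> _] /=.
    exact: same.
  + by move=> l lk; rewrite /update eq_sym (negPf vb) /=; apply: fg.
  + by move=> z' z'f; rewrite /update eq_sym (negPf vb) /=; apply: other.
- move=> k s' ok' vk [same fg other].
  have [fE gE g_small] := body k s' ok' vk same other.
  apply: runs_write => //; rewrite ?fE ?gE //.
  split; first by rewrite /update (negPf vb).
  split.
  + move=> b' b'n a'; rewrite /update; move: (b'n); rewrite !inE negb_or => /andP[_ /negPf->] /=.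
    exact: same.
  + move=> l; rewrite ltnS leq_eqVlt /update eqxx /= => /orP[/eqP/val_inj->|lk].
      by rewrite eqxx.
    by rewrite (inj_eq f_inj) -val_eqE ltn_eqF // fg.
  + move=> z zf; rewrite /update eqxx /= (negPf (zf k _)) //.
    by apply: other => l lk; apply: zf; apply: ltnW.
- move=> s' ok' [same fg other]; apply: stop => // [k|z zf]; first exact: fg.
  by apply: other => l _; apply: zf.
Qed.

End Runs.

(** * The elimination program *)

Lemma same_off_sub bs bs' s s' : all [in bs'] bs ->
  same_off bs s s' -> same_off bs' s s'.
Proof. by move=> /allP sub F b bn; apply: F; apply: contra bn; apply: sub. Qed.

Lemma same_off_trans bs bs1 bs2 s s1 s2 : all [in bs] bs1 -> all [in bs] bs2 ->
  same_off bs1 s s1 -> same_off bs2 s1 s2 -> same_off bs s s2.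
Proof.
move=> /allP sub1 /allP sub2 F1 F2 b bn a.
by rewrite F2 ?F1 //; apply: contra bn; [apply: sub1 | apply: sub2].
Qed.

Lemma same_off_update bs s s1 b a z : same_off bs s s1 -> b \in bs ->
  same_off bs s (update s1 b a z).
Proof.
move=> F bbs b' b'n a'; rewrite /update; case: eqP => [b'b|_]; last exact: F.
by rewrite b'b bbs in b'n.
Qed.

Lemma update_same s b a z : update s b a z b a = z.
Proof. by rewrite /update !eqxx. Qed.

Lemma update_off s b a z b' a' : b' != b -> update s b a z b' a' = s b' a'.
Proof. by rewrite /update => /negPf->. Qed.

Definition addr (i c : expr) : expr :=
  Bin OpAdd (Const 2) (Bin OpAdd (Bin OpMul i (Read 0 (Const 1))) c).

(* Banks 2 to 4 hold the triangular basis, the vector being inserted and a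
   temporary copy of it; the other named banks are scalars stored at address 0.
   Matrices in banks 0 and 2 have row stride n and offset 2, so that row m of
   bank 0 is the characteristic vector of tau. *)
Notation rows := (Read 0 (Const 0)).
Notation columns := (Read 0 (Const 1)).
Notation bout := 1%N (only parsing).
Notation bH := 2%N (only parsing).
Notation bv := 3%N (only parsing).
Notation btmp := 4%N (only parsing).
Notation bd := 5%N (only parsing).
Notation bpiv := 6%N (only parsing).
Notation bmu := 7%N (only parsing).
Notation bq := 8%N (only parsing).
Notation bflag := 9%N (only parsing).
Notation bj := 10%N (only parsing).
Notation bk := 11%N (only parsing).
Notation bi := 12%N (only parsing).
Notation bc := 13%N (only parsing).
Notation br := 14%N (only parsing).
Notation bt := 15%N (only parsing).

(** [bmu] holds a copy of the entry in the pivot column, because row [i] is overwritten in place,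
    that entry included. *)
Definition row_op : cmd :=
  For br columns (Write 0 (addr (var bi) (var br))
    (Bin OpDiv (Bin OpSub (Bin OpMul (var bpiv) (Read 0 (addr (var bi) (var br))))
                          (Bin OpMul (var bmu) (Read 0 (addr (var bj) (var br)))))
               (var bd))).

(** The product of an entry and the characteristic bit of [tau] acts as a conjunction; the last
    suitable column is retained. *)
Definition pivot_step : cmd :=
  Seq (For bc columns
        (If (Bin OpMul (Read 0 (addr (var bj) (var bc))) (Read 0 (addr rows (var bc))))
            (Write bk (Const 0) (var bc)) Skip))
  (Seq (Write bpiv (Const 0) (Read 0 (addr (var bj) (var bk))))
  (Seq (For bi rows (If (Bin OpSub (var bi) (var bj))
                      (Seq (Write bmu (Const 0) (Read 0 (addr (var bi) (var bk)))) row_op)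
                      Skip))
       (Write bd (Const 0) (var bpiv)))).

Definition elimination : cmd :=
  Seq (Write bd (Const 0) (Const 1))
  (Seq (For bj rows pivot_step)
       (If (Bin OpLeq (var bd) (Const 0))
           (Write bd (Const 0) (Bin OpSub (Const 0) (var bd))) Skip)).

(** * Correctness and cost of the elimination *)

Section Program.
Variables (m n K W : nat) (tau : {set 'I_n}).
Implicit Types s : memory.
Hypotheses (K_gt0 : (0 < K)%N) (m_gt0 : (0 < m)%N) (le_mn : (m <= n)%N).
Hypotheses (nW : (n <= W)%N) (nK : (n <= 2 ^ K)%N).

Let mW : (m <= W)%N. Proof. exact: leq_trans le_mn nW. Qed.
Let mK : (m <= 2 ^ K)%N. Proof. exact: leq_trans le_mn nK. Qed.

Definition ix (i c : nat) : int := (2 + (i * n + c))%N.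

Lemma ix_inj (i i' : nat) (c c' : 'I_n) : ix i c = ix i' c' -> i = i' /\ c = c'.
Proof.
move=> [/eqP]; rewrite eqn_add2l => /eqP eq_ic.
have n_gt0 : (0 < n)%N by apply: leq_ltn_trans (ltn_ord c).
have := congr1 (divn^~ n) eq_ic; have := congr1 (modn^~ n) eq_ic.
rewrite !modnMDl !modn_small // !divnMDl // !divn_small // !addn0.
by move=> /val_inj -> ->.
Qed.

Lemma eval_addr s ei ec i c : s 0%N 1 = n -> eval s ei = i%:Z -> eval s ec = c%:Z ->
  eval s (addr ei ec) = ix i c.
Proof. by move=> sn /= -> ->; rewrite sn /ix !PoszD PoszM. Qed.

Definition input (T : 'M[int]_(m, n)) (s : memory) :=
  [/\ s 0%N 0 = m, s 0%N 1 = n, forall (i : 'I_m) (c : 'I_n), s 0%N (ix i c) = T i c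
    & forall c : 'I_n, s 0%N (ix m c) = (c \in tau)%:Z].

Lemma input_same bs T s s' : 0%N \notin bs -> same_off bs s s' ->
  input T s -> input T s'.
Proof. by move=> b0 F [s0 s1 sT st]; split=> *; rewrite F. Qed.

Local Notation runs := (runs K).
Local Notation small := (small K) (only parsing).

Lemma runs_row_op (T T' : 'M[int]_(m, n)) (i j : 'I_m) k d s :
  small_memory K s -> input T s -> i != j ->
  s bi 0 = i -> s bj 0 = j -> s bd 0 = d -> s bpiv 0 = T j k -> s bmu 0 = T i k ->
  (forall c, T' i c = ((T j k * T i c - T i k * T j c)%R %/ d)%Z) ->
  (forall r c, r != i -> T' r c = T r c) -> (forall c, small (T' i c)) ->
  runs row_op (for_time W (2 * opcost)) s
    (fun s' => same_off [:: br; 0%N] s s' /\ input T' s').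
Proof.
move=> ok [s0 s1 sT st] ij si sj sd sp sm T'i T'r T's.
apply: (runs_fill K_gt0 (N := n) (f := ix i) (g := T' i)) => //.
- by move=> c c' /ix_inj[].
- move=> c s' ok' vc F other.
  have s'n : s' 0%N 1 = n by rewrite other.
  have own r (c' : 'I_n) : (r == i :> nat) = false -> s' 0%N (ix r c') = s 0%N (ix r c').
    move=> ri; apply: other => l _; apply/eqP=> /ix_inj[] /eqP; by rewrite ri.
  have Ai : eval s' (addr (var bi) (var br)) = ix i c by apply: eval_addr; rewrite //= F.
  have Aj : eval s' (addr (var bj) (var br)) = ix j c by apply: eval_addr; rewrite //= F.
  split=> //; rewrite /= in Ai Aj *; rewrite Ai Aj (F bpiv) // (F bmu) // (F bd) // sp sm sd (own j c); last first.
    by apply: contra_neqF ij => /eqP/val_inj->.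
  by rewrite other => [|l lc]; rewrite ?T'i ?sT //; apply/eqP=> /ix_inj[_ cl]; rewrite cl ltnn in lc.
- move=> s' ok' F val other; split=> //; split.
  + by rewrite other.
  + by rewrite other.
  + move=> r c; have [->|ri] := eqVneq r i; first by rewrite val.
    rewrite T'r // -sT other // => l; apply/eqP=> /ix_inj[/val_inj E]; by rewrite E eqxx in ri.
  + move=> c; rewrite other // => l; apply/eqP=> /ix_inj[E]; by have := ltn_ord i; rewrite -E ltnn.
Qed.
Lemma input_update T s b a z : b != 0%N -> input T s -> input T (update s b a z).
Proof.
move=> b0; apply: (@input_same [:: b]); last by apply: same_off_update; rewrite ?inE.
by rewrite inE eq_sym.
Qed.

Definition search_time := for_time W (opcost + 2 * opcost).

Definition pivot_time :=
  (search_time + (2 * opcost +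
    (for_time W (opcost + (2 * opcost + for_time W (2 * opcost))) + 2 * opcost)))%N.

Lemma runs_search T (j : 'I_m) s :
  small_memory K s -> input T s -> s bj 0 = j ->
  (exists2 k, k \in tau & T j k != 0) ->
  runs (For bc columns
        (If (Bin OpMul (Read 0 (addr (var bj) (var bc))) (Read 0 (addr rows (var bc))))
            (Write bk (Const 0) (var bc)) Skip)) search_time s
    (fun s' => same_off [:: bc; bk] s s' /\
       exists k : 'I_n, [/\ k \in tau, T j k != 0 & s' bk 0 = k]).
Proof.
move=> ok [s0 s1 sT st] sj [k0 k0t Tk0].
pose found k s' := exists c : 'I_n, [/\ (c < k)%N, c \in tau, T j c != 0 & s' bk 0 = c].
pose I (k : nat) s' := same_off [:: bc; bk] s s' /\ ((k0 < k)%N -> found k s').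
apply: (runs_for K_gt0 (N := n) (I := I)) => //.
- by move=> k s' [F _]; rewrite F.
- move=> k s' z [F fnd]; split; last first.
    by move=> /fnd[c [ck ct Tc E]]; exists c; split=> //; rewrite update_off.
  exact: same_off_update F _.
- move=> c s' ok' vc [F fnd].
  have Ac : eval s' (addr (var bj) (var bc)) = ix j c by apply: eval_addr; rewrite //= F.
  have At : eval s' (addr rows (var bc)) = ix m c by apply: eval_addr; rewrite //= F.
  apply: runs_if => //=; rewrite /= in Ac At; rewrite Ac At !(F 0%N) // sT st => cond.
    apply: runs_write => //=; rewrite vc.
    split; first by rewrite update_off.
    split.
      exact: same_off_update F _.
    move=> _; exists c; split=> //; rewrite ?update_same //.
      by move: cond; rewrite mulf_eq0 negb_or; case: (c \in tau); rewrite // andbF.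
    by move: cond; rewrite mulf_eq0 negb_or => /andP[].
  apply: runs_weaken (runs_skip (Q := fun s'' => s'' = s') _ _ _) _ _ => //.
  move=> s'' ok'' ->; split=> //; split=> //; rewrite ltnS leq_eqVlt => /orP[/eqP/val_inj k0c|].
    by move/eqP: cond; rewrite -k0c k0t mulr1 (negPf Tk0).
  by move=> /fnd[l [lc lt Tl E]]; exists l; split=> //; apply: ltnW.
- by move=> s' _ [F /(_ (ltn_ord k0))[k [_ kt Tk sk]]]; split=> //; exists k.
Qed.

Lemma runs_pivot_step A (j : 'I_m) T d s :
  #|tau| = m -> minor A tau != 0 ->
  (forall i T d, pivot_inv A tau i T d -> small d /\ forall r c, small (T r c)) ->
  small_memory K s -> input T s -> pivot_inv A tau j T d ->
  s bj 0 = j -> s bd 0 = d ->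
  runs pivot_step pivot_time s (fun s' =>
    same_off [:: 0%N; bd; bpiv; bmu; bk; bi; bc; br] s s' /\
    exists T', input T' s' /\ pivot_inv A tau j.+1 T' (s' bd 0)).
Proof.
move=> tau_m minor0 Asmall ok sT inv sj sd.
have Tk := pivot_inv_exists tau_m minor0 inv.
apply: runs_seq; apply: runs_weaken (runs_search ok sT sj Tk) (leqnn _) _.
move=> s1 ok1 [F1 [k [kt Tjk s1k]]] _.
have s1T : input T s1 by apply: input_same F1 sT.
have s1j : s1 bj 0 = j by rewrite F1.
have inv' := pivot_inv_step inv kt Tjk.
have [piv_small T'_small] := Asmall _ _ _ inv'.
have Ak s' : input T s' -> s' bj 0 = j -> s' bk 0 = k -> eval s' (addr (var bj) (var bk)) = ix j k.
  by move=> [_ s'1 _ _] s'j s'k; apply: eval_addr.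
apply: runs_seq; apply: runs_write => //.
  rewrite /=; exact: ok1.
have -> : eval s1 (Read 0 (addr (var bj) (var bk))) = T j k.
  by have [_ _ E _] := s1T; rewrite -E -(Ak s1).
rewrite [eval _ (Const 0)]/=; set s2 := update s1 _ _ _ => ok2.
have s2T : input T s2 by apply: input_update.
(* A hybrid tableau, pivoted above row [i] only. Row [j] is the same in both versions, so it can be
   read throughout the loop. *)
pose P (i : nat) : 'M[int]_(m, n) := \matrix_(r, c) if (r < i)%N then pivot T d j k r c else T r c.
have Pj i c : P i j c = T j c by rewrite !mxE eqxx; case: ifP.
pose I (i : nat) s' := same_off [:: bi; bmu; br; 0%N] s2 s' /\ input (P i) s'.
apply: runs_seq; apply: (runs_for K_gt0 (N := m) (I := I)) => //.
- by move=> i s' [_ []].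
- move=> i s' z [F s'T]; split; last exact: input_update.
  exact: same_off_update F _.
- by split=> //; have [? ? ? ?] := s2T; split=> // r c; rewrite mxE.
- move=> i s' ok' vi [F s'T].
  have s'j : s' bj 0 = j by rewrite F // /s2 update_off.
  have PiE c : P i i c = T i c by rewrite mxE ltnn.
  have PSi r c : r != i -> P i.+1 r c = P i r c.
    by move=> ri; rewrite !mxE ltnS leq_eqVlt val_eqE (negPf ri).
  have PSE c : P i.+1 i c = pivot T d j k i c by rewrite mxE ltnSn.
  apply: runs_if => //=; rewrite vi s'j => cond; last first.
    apply: runs_weaken (runs_skip (Q := fun s'' => s'' = s') _ _ _) _ _ => //.
    move=> s'' ok'' ->; split=> //; split=> //.
    have ij : i = j by apply/val_inj/eqP; rewrite -eqz_nat -subr_eq0 cond.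
    have [? ? E ?] := s'T; split=> // r c; rewrite E.
    have [->|ri] := eqVneq r i; last by rewrite PSi.
    by rewrite PiE PSE ij mxE eqxx.
  have ij : i != j by apply: contraNneq cond => ->; rewrite subrr.
  apply: runs_seq; apply: runs_write => //=.
  set s3 := update s' _ _ _ => ok3.
  have s3T : input (P i) s3 by apply: input_update.
  have F3 : same_off [:: bi; bmu; br; 0%N] s2 s3 by apply: same_off_update F _.
  have mu_val : eval s' (Read 0 (addr (var bi) (var bk))) = T i k.
    have [_ s'1 E _] := s'T; rewrite -PiE -E /= -[2 + _]/(eval s' (addr (var bi) (var bk))).
    by rewrite (@eval_addr _ _ _ i k) //= F // /s2 update_off.
  apply: runs_weaken (runs_row_op (T' := P i.+1) (k := k) (d := d) (j := j) (i := i) ok3 s3T _ _ _ _ _ _ _ _ _) _ _ => //.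
  + by rewrite F3 // /s2 update_off // F1.
  + by rewrite Pj F3 // /s2 update_same.
  + by rewrite PiE /s3 update_same.
  + by move=> c; rewrite PSE !Pj !PiE mxE (negPf ij).
  + by move=> c; rewrite PSE.
  + move=> s4 ok4 [F4 s4T]; split; first by rewrite F4 // /s3 update_off.
    by split=> //; apply: same_off_trans F3 F4.
move=> s3 ok3 [F3 s3T] _; apply: runs_write => //; first exact: ok3.
split.
  have F2 : same_off [:: bc; bk; bpiv] s s2.
    by apply: same_off_update => //; apply: same_off_sub F1.
  by apply: same_off_update => //; apply: same_off_trans F2 F3.
exists (pivot T d j k); split.
  apply: input_update => //; have [? ? E ?] := s3T; split=> // r c.
  by rewrite E mxE ltn_ord.
by rewrite update_same /= F3 // /s2 update_same.
Qed.

Definition elimination_time :=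
  (2 * opcost + (for_time W pivot_time + (opcost + 2 * opcost)))%N.

Lemma runs_elimination A s :
  #|tau| = m -> minor A tau != 0 ->
  (forall i T d, pivot_inv A tau i T d -> small d /\ forall r c, small (T r c)) ->
  small_memory K s -> input A s ->
  runs elimination elimination_time s (fun s' =>
    same_off [:: 0%N; bd; bpiv; bmu; bj; bk; bi; bc; br] s s' /\
    exists T d e, [/\ input T s', pivot_inv A tau m T e, d = `|e| & s' bd 0 = d]).
Proof.
move=> tau_m minor0 Asmall ok sA.
apply: runs_seq; apply: runs_write => //; first exact: expn_gt0.
set s1 := update s _ _ _ => ok1.
pose I (j : nat) s' := same_off [:: 0%N; bd; bpiv; bmu; bj; bk; bi; bc; br] s s' /\
  exists T, input T s' /\ pivot_inv A tau j T (s' bd 0).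
apply: runs_seq; apply: (runs_for K_gt0 (N := m) (I := I)) => //.
- by move=> j s' [_ [T [[]]]].
- move=> j s' z [F [T [s'T inv]]]; split; first exact: same_off_update F _.
  by exists T; rewrite update_off //; split=> //; apply: input_update.
- split; first exact: same_off_update.
  exists A; rewrite /s1 update_same; split; first exact: input_update.
  exact: pivot_inv0.
- move=> j s' ok' vj [F [T [s'T inv]]].
  apply: runs_weaken (runs_pivot_step tau_m minor0 Asmall ok' s'T inv vj erefl) (leqnn _) _.
  move=> s2 ok2 [F2 [T' [s2T' inv']]]; split; first by rewrite F2.
  by split; [apply: same_off_trans F F2 | exists T'].
move=> s2 ok2 [F2 [T [s2T inv]]] _.
have [M [_ d0 _ _ _]] := inv; have [small_d _] := Asmall _ _ _ inv.
apply: runs_if => //=; case: ifP => // dle _.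
  apply: runs_write => //=; first by rewrite sub0r /small abszN.
  split; first exact: same_off_update F2 _.
  exists T, `|s2 bd 0|, (s2 bd 0); split=> //.
  by rewrite update_same; lia.
apply: runs_weaken (runs_skip (Q := fun s'' => s'' = s2) _ _ _) _ _ => //.
move=> s' ok' ->; split=> //; exists T, `|s2 bd 0|, (s2 bd 0); split=> //; lia.
Qed.

End Program.

(** * The selection program *)

Definition remainder (x y : expr) : expr := Bin OpSub x (Bin OpMul (Bin OpDiv x y) y).

Definition swap : cmd :=
  Seq (Write bflag (Const 0) (Const 1))
  (Seq (For br rows (Write btmp (var br) (Read bv (var br))))
  (Seq (For br rows (Write bv (var br) (Read bH (addr (var br) (var bi)))))
       (For br rows (Write bH (addr (var br) (var bi)) (Read btmp (var br)))))).

Definition reduction : cmd :=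
  For br rows (Write bv (var br)
    (remainder (Bin OpSub (Read bv (var br)) (Bin OpMul (var bq) (Read bH (addr (var br) (var bi)))))
               (var bd))).

Definition euclid_step : cmd :=
  Seq (Write bq (Const 0) (Bin OpDiv (Read bv (var bi)) (Read bH (addr (var bi) (var bi)))))
  (Seq reduction (If (Read bv (var bi)) swap Skip)).

Definition insert_vector : cmd :=
  For bi rows (While (Read bv (var bi)) euclid_step).

(* The product of the two pivot entries is at least halved by every step of
   Euclid's algorithm but the first one. *)
Definition euclid_measure (a b : nat) : nat :=
  if a == 0%N then 0%N else ((trunc_log 2 (a * b)).+1 + (a < b))%N.

Lemma euclid_measure_dec a b : (0 < a)%N -> (0 < b)%N -> (0 < a %% b)%N ->
  (euclid_measure b (a %% b) < euclid_measure a b)%N.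
Proof.
move=> a0 b0 r0; have br : (b < a %% b)%N = false by apply/negbTE; rewrite -leqNgt ltnW // ltn_pmod.
rewrite /euclid_measure !gtn_eqF // br addn0 addSn ltnS.
(* When [a < b] the division merely exchanges the two numbers; the extra unit in the measure pays
   for it. *)
have [ab|ba] := ltnP a b; first by rewrite modn_small // mulnC addn1.
rewrite addn0 -trunc_log2_double ?muln_gt0 ?b0 //; apply: leq_trunc_log.
rewrite -muln2 -mulnA [(a * b)%N]mulnC leq_mul2l; apply/orP; right.
(* Here [a] is at least [b + a %% b], hence more than twice the remainder. *)
rewrite {2}(divn_eq a b); have := ltn_pmod a b0; have : (0 < a %/ b)%N by rewrite divn_gt0.
by move: (a %/ b)%N (a %% b)%N => q r; nia.
Qed.

Lemma euclid_measure_bound a b k : (a <= 2 ^ k)%N -> (b <= 2 ^ k)%N ->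
  (euclid_measure a b <= 2 * k + 2)%N.
Proof.
move=> ak bk; rewrite /euclid_measure; case: ifP => // _.
have : (trunc_log 2 (a * b) <= 2 * k)%N.
  by rewrite -(trunc_expnK (p := 2) (2 * k)) // leq_trunc_log // mul2n -addnn expnD leq_mul.
by case: (a < b)%N; lia.
Qed.

Lemma small_range K d z : small K d -> 0 <= z <= d -> small K z.
Proof. by move=> d_small /andP[z0 zd]; apply: leq_trans d_small; lia. Qed.

(** * Correctness and cost of the insertion *)

Section Insert.
Variables (m n K W : nat) (d : int).
Implicit Types s : memory.
Hypotheses (K_gt0 : (0 < K)%N) (m_gt0 : (0 < m)%N) (le_mn : (m <= n)%N).
Hypotheses (nW : (n <= W)%N) (nK : (n <= 2 ^ K)%N).
Hypotheses (d_gt0 : 0 < d) (d_small : small K d).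

Let mW : (m <= W)%N. Proof. exact: leq_trans le_mn nW. Qed.
Let mK : (m <= 2 ^ K)%N. Proof. exact: leq_trans le_mn nK. Qed.

Local Notation runs := (runs K).
Local Notation small := (small K) (only parsing).
Local Notation ix := (ix n).

Definition context s := [/\ s 0%N 0 = m, s 0%N 1 = n & s bd 0 = d].

Definition holdsH (H : 'M[int]_m) s := forall r c : 'I_m, s bH (ix r c) = H r c.

Definition holdsv (v : 'cV[int]_m) s := forall r : 'I_m, s bv (r : nat) = v r 0.

Lemma context_same bs s s' : same_off bs s s' -> context s ->
  all (fun b => b \notin bs) [:: 0%N; bd] -> context s'.
Proof. by move=> F [s0 s1 s5] /and3P[b0 b5 _]; split; rewrite F. Qed.

Lemma holdsH_same bs H s s' : bH \notin bs -> same_off bs s s' ->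
  holdsH H s -> holdsH H s'.
Proof. by move=> b0 F sH r c; rewrite F. Qed.

Lemma holdsv_same bs v s s' : bv \notin bs -> same_off bs s s' ->
  holdsv v s -> holdsv v s'.
Proof. by move=> b0 F sv r; rewrite F. Qed.

Lemma ixm_inj (i i' c c' : 'I_m) : ix i c = ix i' c' -> i = i' /\ c = c'.
Proof.
move=> /(@ix_inj n _ _ (widen_ord le_mn c) (widen_ord le_mn c')).
by move=> [/val_inj-> /(congr1 val) /= /val_inj->].
Qed.

Lemma ord_int_inj k : injective (fun i : 'I_k => (i : nat)%:Z).
Proof. by move=> i i' [/val_inj]. Qed.

Definition fill_time := for_time W (2 * opcost).

Lemma runs_reduction (H : 'M[int]_m) v (i : 'I_m) s :
  small_memory K s -> context s -> holdsH H s -> holdsv v s ->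
  s bi 0 = i -> s bq 0 = ((v i 0)%R %/ H i i)%Z ->
  runs reduction fill_time s
    (fun s' => same_off [:: br; bv] s s' /\ holdsv (reduce d H v i) s').
Proof.
move=> ok [sm sn sd] sH sv si sq.
apply: (runs_fill K_gt0 (N := m) (f := fun r => (r : nat)%:Z) (g := fun r => reduce d H v i r 0)) => //.
- exact: ord_int_inj.
- move=> r s' ok' vr F other.
  have Ar : eval s' (addr (var br) (var bi)) = ix r i by apply: eval_addr; rewrite //= F.
  split=> //; last by apply: (small_range d_small); apply: reduce_range.
  rewrite /= in Ar *; rewrite Ar vr !(F bH) // !(F bq) // !(F bd) // sd sq sH other => [|l lr].
    by rewrite sv mxE.
  by apply: contraTneq lr => /ord_int_inj->; rewrite ltnn.
Qed.

Lemma runs_swap (H : 'M[int]_m) v (i : 'I_m) s :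
  small_memory K s -> context s -> holdsH H s -> holdsv v s -> s bi 0 = i ->
  runs swap (2 * opcost + (fill_time + (fill_time + fill_time))) s
    (fun s' => [/\ same_off [:: bflag; br; btmp; bv; bH] s s', holdsH (exchange H i v) s',
       holdsv (col i H) s' & s' bflag 0 = 1]).
Proof.
move=> ok sc sH sv si.
apply: runs_seq; apply: runs_write => //; first by rewrite /small expn_gt0.
rewrite /=; set s1 := update s _ _ _ => ok1.
have F1 : same_off [:: bflag] s s1 by apply: same_off_update.
have [sm sn sd] := context_same F1 sc isT.
apply: runs_seq.
apply: (runs_fill K_gt0 (N := m) (f := fun r => (r : nat)%:Z) (g := fun r => v r 0)) => //.
- exact: ord_int_inj.
- move=> r s' ok' vr F _; have E : eval s' (Read bv (var br)) = v r 0.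
    by rewrite /= F // vr F1 // sv.
  by split; [| | rewrite -E; apply: ok'].
move=> s2 ok2 F2 val2 _ _.
have fl2 : s2 bflag 0 = 1 by rewrite F2 // /s1 update_same.
have {}F2 : same_off [:: bflag; br; btmp] s s2 by apply: same_off_trans F1 F2.
have [{}sm {}sn {}sd] := context_same F2 sc isT.
apply: runs_seq.
apply: (runs_fill K_gt0 (N := m) (f := fun r => (r : nat)%:Z) (g := fun r => H r i)) => //.
- exact: ord_int_inj.
- move=> r s' ok' vr F _.
  have Ar : eval s' (addr (var br) (var bi)) = ix r i by apply: eval_addr; rewrite //= F // F2.
  have E : eval s' (Read bH (addr (var br) (var bi))) = H r i.
    by rewrite -[LHS]/(s' bH (eval s' (addr (var br) (var bi)))) Ar F // F2 // sH.
  by split; [| | rewrite -E; apply: ok'].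
move=> s3 ok3 F3 val3 _ _.
have fl3 : s3 bflag 0 = 1 by rewrite F3.
have tmp3 (r : 'I_m) : s3 btmp (r : nat) = v r 0 by rewrite F3 // val2.
have {}F3 : same_off [:: bflag; br; btmp; bv] s s3 by apply: same_off_trans F2 F3.
have [{}sm {}sn {}sd] := context_same F3 sc isT.
apply: (runs_fill K_gt0 (N := m) (f := fun r : 'I_m => ix r i) (g := fun r => v r 0)) => //.
- by move=> r r' /ixm_inj[].
- move=> r s' ok' vr F _.
  have Ar : eval s' (addr (var br) (var bi)) = ix r i by apply: eval_addr; rewrite //= F // F3.
  have E : eval s' (Read btmp (var br)) = v r 0 by rewrite /= F // vr tmp3.
  by split; [| | rewrite -E; apply: ok'].
move=> s4 ok4 F4 val4 other4.
have F5 : same_off [:: bflag; br; btmp; bv; bH] s s4 by apply: same_off_trans F3 F4.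
split=> //.
- move=> r c; rewrite mxE; have [->|ci] := eqVneq c i; first by rewrite val4.
  rewrite other4 => [|l]; first by rewrite F3.
  by apply: contraNneq ci => /ixm_inj[_ ->].
- by move=> r; rewrite F4 // val3 mxE.
by rewrite F4.
Qed.

Definition state (H0 : 'M[int]_m) (v0 : 'cV[int]_m) (k : nat) s :=
  exists H v (flag : bool),
    [/\ holdsH H s, holdsv v s, s bflag 0 = flag & insertion d H0 v0 k H v flag].

Definition measure (i : 'I_m) s :=
  euclid_measure `|s bv (i : nat)| `|s bH (ix i i)|.

Definition euclid_time :=
  (2 * opcost + (fill_time + (opcost + (2 * opcost + (fill_time + (fill_time + fill_time))))))%N.

Lemma runs_euclid_step H0 v0 (i : 'I_m) s :
  small_memory K s -> context s -> s bi 0 = i -> state H0 v0 i s -> s bv (i : nat) != 0 ->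
  runs euclid_step euclid_time s (fun s' =>
    [/\ same_off [:: bH; bv; btmp; bq; bflag; br] s s', state H0 v0 i s'
      & (measure i s' < measure i s)%N]).
Proof.
move=> ok sc si [H [v [flag [sH sv sfl ins]]]] si0.
have [[sm sn sd] [[tri diag Hd] [vd _] _ _ _]] := (sc, ins).
have vi0 : v i 0 != 0 by rewrite -sv.
have Aii s' : context s' -> s' bi 0 = i -> eval s' (addr (var bi) (var bi)) = ix i i.
  by move=> [_ s'n _] s'i; apply: eval_addr.
apply: runs_seq; apply: runs_write => //.
  by rewrite /= si; apply: leq_trans (absz_divz _ _) _; apply: ok.
have -> : eval s (Bin OpDiv (Read bv (var bi)) (Read bH (addr (var bi) (var bi)))) =
    ((v i 0)%R %/ H i i)%Z.
  have := Aii s sc si; rewrite /= => ->; by rewrite si sv sH.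
rewrite /=; set s1 := update s _ _ _ => ok1.
have F1 : same_off [:: bq] s s1 by apply: same_off_update.
have s1c := context_same F1 sc isT.
have s1H : holdsH H s1 by apply: holdsH_same F1 sH.
have s1v : holdsv v s1 by apply: holdsv_same F1 sv.
apply: runs_seq; apply: runs_weaken (runs_reduction (i := i) ok1 s1c s1H s1v _ _) (leqnn _) _.
- by rewrite F1.
- by rewrite /s1 update_same.
move=> s2 ok2 [F2 s2v] _.
have {}F2 : same_off [:: bq; br; bv] s s2 by apply: same_off_trans F1 F2.
have s2c := context_same F2 sc isT.
have s2H : holdsH H s2 by apply: holdsH_same F2 sH.
have s2i : s2 bi 0 = i by rewrite F2.
have [a va] : exists a : nat, v i 0 = a.
  by exists (absz (v i 0)); rewrite gez0_abs //; case/andP: (vd i).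
have [b Hb] : exists b : nat, H i i = b.
  by exists (absz (H i i)); rewrite gez0_abs // ltW.
have a_gt0 : (0 < a)%N by move: vi0; rewrite va; lia.
have b_gt0 : (0 < b)%N by have := diag i; rewrite Hb; lia.
have rE : reduce d H v i i 0 = (a %% b)%N by rewrite (reduce_pivot d_gt0 ins) va Hb modz_nat.
have mu_s : measure i s = euclid_measure a b by rewrite /measure sv sH va Hb.
apply: runs_if => //=; rewrite s2i s2v rE => cond; last first.
  apply: runs_weaken (runs_skip (Q := fun s'' => s'' = s2) _ _ _) _ _ => //.
  move=> s' ok' ->; split.
  - exact: same_off_sub F2.
  - exists H, (reduce d H v i), flag; split=> //; first by rewrite F2.
    exact: insertion_reduce.
  - rewrite mu_s /measure s2v rE cond /euclid_measure eqxx gtn_eqF //.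
apply: runs_weaken (runs_swap (i := i) ok2 s2c s2H s2v _) (leqnn _) _ => //.
move=> s3 ok3 [F3 s3H s3v s3fl]; split.
- exact: same_off_trans F2 F3.
- exists (exchange H i (reduce d H v i)), (col i H), true; split=> //.
  by apply: insertion_swap ins _ => //; rewrite rE.
- rewrite mu_s /measure s3v s3H [col i H i 0]mxE [exchange _ _ _ _ _]mxE eqxx.
  rewrite rE Hb; apply: euclid_measure_dec => //; by rewrite lt0n.
Qed.

Definition insert_time :=
  for_time W ((2 * K + 2) * (opcost + euclid_time) + opcost).

Lemma runs_insert_vector H0 (v0 : 'cV[int]_m) s :
  small_memory K s -> context s -> hermite d H0 -> (forall r : 'I_m, 0 <= v0 r 0 <= d) ->
  holdsH H0 s -> holdsv v0 s -> s bflag 0 = 0 ->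
  runs insert_vector insert_time s (fun s' =>
    same_off [:: bH; bv; btmp; bq; bflag; bi; br] s s' /\
    exists H (flag : bool),
      [/\ holdsH H s', s' bflag 0 = flag, hermite d H,
          forall x, lattice H x <-> lattice_with H0 v0 x & ~~ flag <-> lattice H0 v0]).
Proof.
move=> ok sc hH0 v0d sH sv sfl.
pose I (k : nat) s' := same_off [:: bH; bv; btmp; bq; bflag; bi; br] s s' /\ state H0 v0 k s'.
apply: (runs_for K_gt0 (N := m) (I := I)) => //.
- by move=> k s' [F _]; have [sm sn sd] := sc; rewrite F.
- move=> k s' z [F [H [v [flag [s'H s'v s'f ins]]]]]; split; first exact: same_off_update F _.
  exists H, v, flag; split=> //; by rewrite update_off.
- split=> //; exists H0, v0, false; split=> //; exact: insertion0.
- move=> i s' ok' vi [F st].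
  pose J s'' := same_off [:: bH; bv; btmp; bq; bflag; br] s' s'' /\ state H0 v0 i s''.
  have Jc s'' : J s'' -> context s''.
    move=> [F' _]; have F2 : same_off [:: bH; bv; btmp; bq; bflag; bi; br] s s'' by apply: same_off_trans F F'.
    exact: context_same F2 sc isT.
  apply: (runs_while K_gt0 (I := J) (mu := measure i)) => //.
  + move=> s2 ok2 Js2 /=; have [F2 st2] := Js2; rewrite (F2 bi) // vi => cond.
    apply: runs_weaken (runs_euclid_step ok2 (Jc _ Js2) _ st2 cond) (leqnn _) _; first by rewrite F2.
    by move=> s3 ok3 [F3 st3 mu3]; split=> //; split=> //; apply: same_off_trans F2 F3.
  + move=> s2 ok2 Js2 /=; have [F2 [H [v [flag [s2H s2v s2f ins]]]]] := Js2.
    rewrite (F2 bi) // vi => cond; split=> //.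
    split; first by apply: same_off_trans F F2.
    by exists H, v, flag; split=> //; apply: insertionS ins _; rewrite -s2v.
  + by apply: euclid_measure_bound; apply: ok'.
move=> s' ok' [F [H [v [flag [s'H s'v s'f ins]]]]]; split=> //.
have [hH latE flE] := insertion_end hH0 ins.
by exists H, flag; split.
Qed.

End Insert.

(** * Lattices modulo d *)

Section ModularLattice.
Variables (m n : nat) (d : int) (T : 'M[int]_(m, n)).
Hypothesis d_gt0 : 0 < d.

(* Columns of tau yield d e_i, so for X containing tau this is just the lattice
   spanned by the columns in X; see [modlat_span]. *)
Definition modlat (X : {set 'I_n}) (x : 'cV[int]_m) :=
  exists2 u : 'cV[int]_n, (forall c, c \notin X -> u c 0 = 0)
    & exists z, x = T *m u + d *: z.

Lemma modlat0 x : modlat set0 x <-> lattice (d%:M : 'M_m) x.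
Proof.
split=> [[u u0 [z ->]]|[z ->]].
  have -> : u = 0 by apply/colP=> c; rewrite u0 ?inE // mxE.
  by exists z; rewrite mulmx0 add0r mul_scalar_mx.
exists 0 => [c _|]; first by rewrite mxE.
by exists z; rewrite mulmx0 add0r mul_scalar_mx.
Qed.

Lemma modlatDz X x z : modlat X (x + d *: z) <-> modlat X x.
Proof.
have aux y w : modlat X y -> modlat X (y + d *: w).
  by move=> [u u0 [w' ->]]; exists u => //; exists (w' + w); rewrite scalerDr addrA.
by split=> [/(aux _ (- z))|/aux//]; rewrite scalerN addrK.
Qed.

Lemma modlatU c X x : modlat (c |: X) x <-> exists t : int, modlat X (x - t *: col c T).
Proof.
split=> [[u u0 [z ->]]|[t [u u0 [z xE]]]].
  exists (u c 0), (u - u c 0 *: delta_mx c 0) => [c' c'X|].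
    rewrite !mxE andbT; have [->|c'c] := eqVneq c' c; first by rewrite mulr1 subrr.
    by rewrite (u0 c') ?inE ?negb_or ?c'c //= mulr0 subrr.
  by exists z; rewrite mulmxBr -scalemxAr -colE addrAC.
exists (u + t *: delta_mx c 0) => [c'|].
  rewrite !inE negb_or => /andP[c'c /u0 u0']; by rewrite !mxE u0' (negPf c'c) mulr0 addr0.
exists z; rewrite mulmxDr -scalemxAr -colE addrAC -xE.
by rewrite subrK.
Qed.

Lemma hermite_scalar : hermite d (d%:M : 'M_m).
Proof.
split=> [|r]; last by exists (delta_mx r 0); rewrite mul_scalar_mx.
split=> [r s rs|s|r s]; rewrite mxE.
- by rewrite -val_eqE ltn_eqF.
- by rewrite eqxx.
- by case: (r == s); rewrite ?lexx ?ltW.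
Qed.

Definition masked_col (b : bool) (c : 'I_n) : 'cV[int]_m :=
  \col_r ((T r c * b%:Z)%R %% d)%Z.

Lemma masked_colE b c : exists w, masked_col b c = b%:Z *: col c T + d *: w.
Proof.
exists (- \col_r ((T r c * b%:Z)%R %/ d)%Z); apply/colP=> r; rewrite !mxE /modz.
by rewrite mulrN; congr (_ - _); rewrite mulrC.
Qed.

Lemma masked_col_range b c r : 0 <= masked_col b c r 0 <= d.
Proof. by rewrite mxE modz_ge0 ?gt_eqF //= ltW // ltz_pmod. Qed.

Lemma lattice_with_masked (H : 'M[int]_m) b c X x :
  (forall y, lattice H y <-> modlat X y) ->
  lattice_with H (masked_col b c) x <-> modlat (if b then c |: X else X) x.
Proof.
move=> HX; have [w ->] := masked_colE b c; case: b.
  rewrite modlatU scale1r.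
  have E (t : int) : modlat X (x - t *: (col c T + d *: w)) <-> modlat X (x - t *: col c T).
    rewrite -(modlatDz _ (x - t *: col c T) (- t *: w)).
    by rewrite !scalerDr !scalerA opprD addrA mulrN scaleNr [t * d]mulrC.
  by split=> -[t] => [/HX/E|/E/HX] ?; exists t.
have E (t : int) : modlat X (x - t *: (0 *: col c T + d *: w)) <-> modlat X x.
  rewrite -(modlatDz _ x (- t *: w)).
  by rewrite scale0r add0r !scalerA mulrN scaleNr [t * d]mulrC.
split=> [[t /HX/E //]|Xx]; by exists 0; apply/HX/E.
Qed.

Lemma modlat_masked c X : modlat X (masked_col true c) <-> modlat X (col c T).
Proof. by have [w ->] := masked_colE true c; rewrite modlatDz scale1r. Qed.

Lemma modlat_span (tau X : {set 'I_n}) e x : d = `|e| ->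
  (forall i : 'I_m, exists2 k, k \in tau & col k T = e *: delta_mx i 0) ->
  tau \subset X -> modlat X x <-> span_on T X x.
Proof.
move=> dE tauT /subsetP tX; split=> [[u u0 [z ->]]|[u u0 ->]]; last first.
  by exists u => //; exists 0; rewrite scaler0 addr0.
have [f ft fT] := fin_all_exists2 tauT.
(* The sign of [e]: elimination leaves a pivot of either sign, whereas the modulus [d] is
   positive. *)
pose t := if 0 <= e then 1 else -1 : int.
have dt : d = t * e by rewrite dE /t; case: ifP => e0; lia.
exists (u + t *: \sum_i z i 0 *: delta_mx (f i) 0) => [c cX|].
  rewrite !mxE u0 // summxE big1 ?mulr0 ?add0r // => i _; rewrite !mxE andbT.
  by case: eqP cX => [->|_ _]; rewrite ?mulr0 // tX.
rewrite mulmxDr -scalemxAr mulmx_sumr; congr (_ + _).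
rewrite dt -scalerA; congr (_ *: _); apply/colP=> r.
rewrite mxE summxE (bigD1 r) //= big1 => [|i ir].
  by rewrite -scalemxAr -colE fT !mxE !eqxx mulr1 addr0 mulrC.
by rewrite -scalemxAr -colE fT !mxE eq_sym (negPf ir) !mulr0.
Qed.

End ModularLattice.

Lemma span_on_sub m n (T : 'M[int]_(m, n)) (X Z : {set 'I_n}) x :
  X \subset Z -> span_on T X x -> span_on T Z x.
Proof.
move=> /subsetP XZ [u u0 ->]; exists u => // c cZ; apply: u0.
by apply: contra cZ; apply: XZ.
Qed.

Lemma span_onD m n (T : 'M[int]_(m, n)) X x y :
  span_on T X x -> span_on T X y -> span_on T X (x + y).
Proof.
move=> [u u0 ->] [v v0 ->]; exists (u + v); last by rewrite mulmxDr.
by move=> c cX; rewrite mxE u0 // v0 // addr0.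
Qed.

Lemma span_onZ m n (T : 'M[int]_(m, n)) X t x : span_on T X x -> span_on T X (t *: x).
Proof.
move=> [u u0 ->]; exists (t *: u); last by rewrite scalemxAr.
by move=> c cX; rewrite mxE u0 // mulr0.
Qed.

Lemma span_on_cols m n (T : 'M[int]_(m, n)) (X Z : {set 'I_n}) x :
  (forall c, c \in X -> span_on T Z (col c T)) -> span_on T X x -> span_on T Z x.
Proof.
move=> XZ [u u0 ->]; rewrite mulmx_cols; apply: big_ind.
- by exists 0 => [c _|]; rewrite ?mulmx0 ?mxE.
- exact: span_onD.
- move=> c _; have [/XZ|/u0->] := boolP (c \in X); first exact: span_onZ.
  by rewrite scale0r; exists 0 => [c' _|]; rewrite ?mulmx0 ?mxE.
Qed.

Lemma span_on_col m n (T : 'M[int]_(m, n)) (X : {set 'I_n}) c :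
  c \in X -> span_on T X (col c T).
Proof.
move=> cX; exists (delta_mx c 0); last by rewrite colE.
by move=> c' c'X; rewrite mxE andbT; case: eqP c'X => // ->; rewrite cX.
Qed.

(** The product of the two comparisons is the indicator of the diagonal. *)
Definition init_H : cmd :=
  For bi rows (For br rows (Write bH (addr (var bi) (var br))
    (Bin OpMul (var bd) (Bin OpMul (Bin OpLeq (var bi) (var br)) (Bin OpLeq (var br) (var bi)))))).

Definition load : cmd :=
  For br rows (Write bv (var br)
    (remainder (Bin OpMul (Read 0 (addr (var br) (var bc))) (Read bout (var bc))) (var bd))).

(* The columns are inserted in the cyclic order that ends with column j, so that
   the flag finally tells whether column j is redundant; a column already
   discarded is masked by its output bit and inserted as the zero vector. *)
Definition insert_column : cmd :=
  Seq (Write bc (Const 0) (remainder (Bin OpAdd (Bin OpAdd (var bj) (Const 1)) (var bt)) columns))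
  (Seq (Write bflag (Const 0) (Const 0)) (Seq load insert_vector)).

(** The basis restarts from [d] times the identity for every [j], because the set of other remaining
    columns changes. The final comparison is a disjunction that always keeps [tau]. *)
Definition select_step : cmd :=
  Seq init_H
  (Seq (For bt columns insert_column)
       (Write bout (var bj) (Bin OpLeq (Const 1) (Bin OpAdd (var bflag) (Read 0 (addr rows (var bj))))))).

Definition init_out : cmd := For br columns (Write bout (var br) (Const 1)).

Definition selection : cmd := Seq init_out (For bj columns select_step).

(** * The cyclic order of the columns *)

Section Rotation.
Variable n : nat.

Definition rotate (j l : 'I_n) : 'I_n :=
  Ordinal (ltn_pmod (j.+1 + l) (leq_ltn_trans (leq0n j) (ltn_ord j))).

Lemma rotate_inj j : injective (rotate j).
Proof.
move=> l l' /(congr1 val) /= /eqP; rewrite eqn_modDl !modn_small //.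
by move=> /eqP/val_inj.
Qed.

Lemma rotate_last (j l : 'I_n) : l.+1 = n -> rotate j l = j.
Proof.
move=> ln; apply: val_inj; rewrite /= addSnnS ln modnDr modn_small //.
Qed.

(** The columns of [g] met in the first [k] insertions of the round that ends with [j]. *)
Definition rotated (g : {set 'I_n}) (j : 'I_n) (k : nat) : {set 'I_n} :=
  [set c in g | [exists l : 'I_n, (l < k)%N && (rotate j l == c)]].

Lemma rotated0 g j : rotated g j 0 = set0.
Proof. by apply/setP=> c; rewrite !inE; apply/andP=> -[_ /existsP[]]. Qed.

Lemma rotatedS g j (l : 'I_n) :
  rotated g j l.+1 = if rotate j l \in g then rotate j l |: rotated g j l else rotated g j l.
Proof.
apply/setP=> c.
have E : [exists l' : 'I_n, (l' < l.+1)%N && (rotate j l' == c)] =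
    (c == rotate j l) || [exists l' : 'I_n, (l' < l)%N && (rotate j l' == c)].
  apply/existsP/orP=> [[l']|[/eqP->|/existsP[l' /andP[ll' E]]]].
  - rewrite ltnS leq_eqVlt => /andP[/orP[/eqP/val_inj->|ll'] E].
      by left; rewrite eq_sym.
    by right; apply/existsP; exists l'; rewrite ll'.
  - by exists l; rewrite ltnSn eqxx.
  - by exists l'; rewrite E andbT ltnW.
rewrite inE E; case: ifP => rg; rewrite !inE.
  by case: (eqVneq c (rotate j l)) => [->|_] //=; rewrite rg.
by case: (eqVneq c (rotate j l)) => [->|_] //=; rewrite rg.
Qed.

Lemma rotated_last g (j l : 'I_n) : l.+1 = n -> rotated g j l = g :\ j.
Proof.
move=> ln; apply/setP=> c; rewrite !inE andbC; case: (c \in g); rewrite ?andbF // !andbT.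
have [inv _ invK] := injF_bij (@rotate_inj j).
apply/existsP/idP=> [[l' /andP[ll' /eqP<-]]|cj].
  by rewrite -[X in _ != X](rotate_last j ln) (inj_eq (@rotate_inj j)) -val_eqE ltn_eqF.
exists (inv c); rewrite invK eqxx andbT ltn_neqAle.
have -> : (inv c <= l)%N by rewrite -ltnS ln.
by rewrite andbT; apply: contraNneq cj => /val_inj E; rewrite -(invK c) E rotate_last.
Qed.

End Rotation.

(** * Correctness and cost of the selection *)

Section Select.
Variables (m n K W : nat) (tau : {set 'I_n}) (d : int) (T : 'M[int]_(m, n)).
Implicit Types s : memory.
Hypotheses (K_gt0 : (0 < K)%N) (m_gt0 : (0 < m)%N) (le_mn : (m <= n)%N).
Hypotheses (nW : (n <= W)%N) (nK : (n <= 2 ^ K)%N).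
Hypotheses (d_gt0 : 0 < d) (d_small : small K d).

Let mW : (m <= W)%N. Proof. exact: leq_trans le_mn nW. Qed.
Let mK : (m <= 2 ^ K)%N. Proof. exact: leq_trans le_mn nK. Qed.

Local Notation runs := (runs K).
Local Notation small := (small K) (only parsing).
Local Notation ix := (ix n).
Local Notation context := (context m n d).
Local Notation holdsH := (holdsH n).
Local Notation fill_time := (fill_time W).

Lemma runs_init_H s : small_memory K s -> context s ->
  runs init_H (for_time W fill_time) s
    (fun s' => same_off [:: bH; bi; br] s s' /\ holdsH (d%:M : 'M_m) s').
Proof.
move=> ok sc; have [sm sn sd] := sc.
pose I (k : nat) s' := same_off [:: bH; bi; br] s s' /\
  forall r c : 'I_m, (r < k)%N -> s' bH (ix r c) = (d%:M : 'M_m) r c.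
apply: (runs_for K_gt0 (N := m) (I := I)) => //.
- by move=> k s' [F _]; rewrite F.
- move=> k s' z [F E]; split; first exact: same_off_update F _.
  by move=> r c rk; rewrite update_off // E.
- move=> i s' ok' vi [F E].
  apply: (runs_fill K_gt0 (N := m) (f := fun c : 'I_m => ix i c)
            (g := fun c => (d%:M : 'M_m) i c)) => //.
  + by rewrite F.
  + by move=> c c' /(ixm_inj le_mn)[].
  + move=> c s2 ok2 vc F2 _; split.
    * by apply: eval_addr => //=; rewrite F2 // F.
    * rewrite /= vc !(F2 bi) // vi !(F2 bd) // !(F bd) // sd mxE -val_eqE.
      by rewrite !lez_nat; case: ltngtP; rewrite ?mulr0 ?mul0r ?mulr1.
    * apply: (small_range d_small); rewrite mxE; case: (i == c); rewrite ?lexx ?ltW //.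
  + move=> s2 ok2 F2 val other; split; first by rewrite F2.
    split; first by apply: same_off_trans F F2.
    move=> r c; rewrite ltnS leq_eqVlt => /orP[/eqP/val_inj->|ri]; first exact: val.
    rewrite other ?E // => c'; apply/eqP=> /(ixm_inj le_mn)[ri' _].
    by rewrite ri' ltnn in ri.
- by move=> s' _ [F E]; split=> // r c; apply: E.
Qed.

Lemma runs_load (c : 'I_n) (b : bool) s :
  small_memory K s -> context s -> s bc 0 = c -> s bout (c : nat) = b ->
  (forall r : 'I_m, s 0%N (ix r c) = T r c) ->
  runs load fill_time s
    (fun s' => same_off [:: br; bv] s s' /\ holdsv (masked_col d T b c) s').
Proof.
move=> ok [sm sn sd] sc sb sT.
apply: (runs_fill K_gt0 (N := m) (f := fun r => (r : nat)%:Z) (g := fun r => masked_col d T b c r 0)) => //.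
- exact: ord_int_inj.
- move=> r s' ok' vr F _.
  have Ar : eval s' (addr (var br) (var bc)) = ix r c by apply: eval_addr; rewrite //= F.
  split=> //; last by apply: (small_range d_small); apply: masked_col_range.
  rewrite /= in Ar *; rewrite Ar !(F bc) // !(F bd) // sd sc !(F bout) // sb !(F 0%N) // sT.
  by rewrite mxE.
Qed.

Definition insert_column_time :=
  (2 * opcost + (2 * opcost + (fill_time + insert_time K W)))%N.

Lemma runs_insert_column (j l : 'I_n) (g : {set 'I_n}) (H : 'M[int]_m) X s :
  small_memory K s -> context s -> input tau T s -> s bj 0 = j -> s bt 0 = l ->
  (forall c : 'I_n, s bout (c : nat) = (c \in g)) ->
  holdsH H s -> hermite d H -> (forall x, lattice H x <-> modlat d T X x) ->
  runs insert_column insert_column_time s (fun s' =>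
    same_off [:: bH; bv; btmp; bq; bflag; bi; bc; br] s s' /\
    exists H' (flag : bool),
      [/\ holdsH H' s', s' bflag 0 = flag, hermite d H',
          forall x, lattice H' x <->
            modlat d T (if rotate j l \in g then rotate j l |: X else X) x
        & rotate j l \in g -> (~~ flag <-> modlat d T X (col (rotate j l) T))]).
Proof.
move=> ok sc sT sj sl sg sH hH HX; have [sm sn sd] := sc.
have rot_val : eval s (remainder (Bin OpAdd (Bin OpAdd (var bj) (Const 1)) (var bt)) columns)
    = rotate j l.
  rewrite /= sj sl sn -[_ - _]/(modz _ _).
  by rewrite (_ : (j : nat)%:Z + 1 + (l : nat)%:Z = (j.+1 + l)%N) ?modz_nat //; lia.
apply: runs_seq; apply: runs_write => //; rewrite rot_val.
  by apply: leq_trans (ltnW (ltn_ord _)) nK.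
rewrite [eval _ _]/=; set c := rotate j l; set s1 := update s _ _ _ => ok1.
have F1 : same_off [:: bc] s s1 by apply: same_off_update.
have s1c : s1 bc 0 = c by rewrite /s1 update_same.
apply: runs_seq; apply: runs_write => //; rewrite /=; set s2 := update s1 _ _ _ => ok2.
have F2 : same_off [:: bc; bflag] s s2 by apply: same_off_update => //; apply: same_off_sub F1.
have s2c := context_same F2 sc isT.
have [_ _ s0T _] := sT.
apply: runs_seq; apply: runs_weaken (runs_load (c := c) (b := c \in g) ok2 s2c _ _ _) (leqnn _) _.
- by rewrite /s2 update_off.
- by rewrite F2.
- by move=> r; rewrite F2.
move=> s3 ok3 [F3 s3v] _.
have fl3 : s3 bflag 0 = 0 by rewrite F3 // /s2 update_same.
have {}F3 : same_off [:: bc; bflag; br; bv] s s3 by apply: same_off_trans F2 F3.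
have s3c := context_same F3 sc isT.
have s3H : holdsH H s3 by apply: holdsH_same F3 sH.
apply: runs_weaken (runs_insert_vector K_gt0 m_gt0 le_mn nW nK d_gt0 d_small ok3 s3c hH _ s3H s3v fl3) (leqnn _) _.
  by move=> r; apply: masked_col_range.
move=> s4 ok4 [F4 [H' [flag [s4H s4fl hH' latE flE]]]]; split; first by apply: same_off_trans F3 F4.
exists H', flag; split=> // [x|cg].
  by rewrite latE; apply: lattice_with_masked.
by rewrite flE HX cg modlat_masked.
Qed.

Definition select_time :=
  (for_time W fill_time + (for_time W insert_column_time + 2 * opcost))%N.

Lemma runs_select_step (j : 'I_n) (g : {set 'I_n}) s :
  small_memory K s -> context s -> input tau T s -> s bj 0 = j ->
  (forall c : 'I_n, s bout (c : nat) = (c \in g)) -> j \in g ->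
  runs select_step select_time s (fun s' =>
    same_off [:: bout; bH; bv; btmp; bq; bflag; bi; bc; br; bt] s s' /\
    exists2 flag : bool, ~~ flag <-> modlat d T (g :\ j) (col j T)
      & forall a, s' bout a = if a == (j : nat) then ((flag || (j \in tau)) : nat)%:Z else s bout a).
Proof.
move=> ok sc sT sj sg jg; have [sm sn sd] := sc.
apply: runs_seq; apply: runs_weaken (runs_init_H ok sc) (leqnn _) _.
move=> s1 ok1 [F1 s1H] _.
(* The flag cell has a meaning only after an insertion, whence the guard [0 < k]; each insertion
   starts by resetting it. *)
pose I (k : nat) s' := same_off [:: bH; bv; btmp; bq; bflag; bi; bc; br; bt] s s' /\
  exists (H : 'M[int]_m) (flag : bool),
    [/\ holdsH H s', (0 < k)%N -> s' bflag 0 = flag, hermite d H,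
        forall x, lattice H x <-> modlat d T (rotated g j k) x
      & forall l : 'I_n, l.+1 = k -> rotate j l \in g ->
          (~~ flag <-> modlat d T (rotated g j l) (col (rotate j l) T))].
apply: runs_seq; apply: (runs_for K_gt0 (N := n) (I := I)) => //.
- by move=> k s' [F _]; rewrite F.
- move=> k s' z [F [H [flag [s'H fl hH HX flE]]]]; split; first exact: same_off_update F _.
  by exists H, flag; split=> //; rewrite update_off.
- split; first by apply: same_off_sub F1.
  exists d%:M, false; split=> //; first exact: hermite_scalar.
  by move=> x; rewrite rotated0 modlat0.
- move=> l s' ok' vl [F [H [flag [s'H _ hH HX _]]]].
  have s'c := context_same F sc isT.
  have s'T : input tau T s' by apply: input_same F sT.
  apply: runs_weaken (runs_insert_column (j := j) (l := l) (g := g) ok' s'c s'T _ vl _ s'H hH HX) (leqnn _) _.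
  + by rewrite F.
  + by move=> c; rewrite F.
  move=> s2 ok2 [F2 [H' [flag' [s2H s2fl hH' HX' flE']]]]; split; first by rewrite F2.
  split; first by apply: same_off_trans F F2.
  exists H', flag'; split=> //.
  + by move=> x; rewrite rotatedS.
  + by move=> l' [/val_inj ->].
move=> s2 ok2 [F2 [H [flag [_ s2fl _ _ flE]]]] _.
have n_gt0 : (0 < n)%N by apply: leq_trans le_mn.
have s2T : input tau T s2 by apply: input_same F2 sT.
have [_ s2n _ s2t] := s2T; have s2j : s2 bj 0 = j by rewrite F2.
have At : eval s2 (addr rows (var bj)) = ix m j by apply: eval_addr => //; case: s2T.
have val : eval s2 (Bin OpLeq (Const 1) (Bin OpAdd (var bflag) (Read 0 (addr rows (var bj)))))
    = (flag || (j \in tau)).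
  by rewrite /= in At *; rewrite At s2fl // s2t; case: (flag) (j \in tau) => [] [].
apply: runs_write => //; rewrite val; first by case: (flag || _); rewrite /small ?expn_gt0.
split.
  by apply: same_off_update => //; apply: same_off_sub F2.
(* The last insertion of the round tests [j] itself against [g :\ j], and its flag is the answer. *)
have [l ln] : exists l : 'I_n, l.+1 = n.
  have lt_pn : (n.-1 < n)%N by rewrite ltn_predL.
  by exists (Ordinal lt_pn); rewrite /= prednK.
exists flag; first by have := flE l ln; rewrite rotate_last // rotated_last //; apply.
by move=> a; rewrite /= s2j /update eqxx /=; case: eqP => // _; rewrite F2.
Qed.

Lemma bank_set_word (g : {set 'I_n}) (f : int -> int) :
  (forall c : 'I_n, f (c : nat) = (c \in g)) ->
  (forall a : int, (forall c : 'I_n, a != (c : nat)%:Z) -> f a = 0) -> f =1 bank (set_word g).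
Proof.
move=> fg f0 [k|k]; last by apply: f0.
rewrite /= /set_word; have [lt_kn|le_nk] := ltnP k n; last first.
  rewrite f0 => [|c]; last by have := ltn_ord c; lia.
  by rewrite nth_default // size_map size_enum_ord.
rewrite (nth_map (Ordinal lt_kn)) ?size_enum_ord // (nth_ord_enum _ (Ordinal lt_kn)).
exact: fg (Ordinal lt_kn).
Qed.

Lemma bank_set_wordE (g : {set 'I_n}) (c : 'I_n) : bank (set_word g) (c : nat) = (c \in g).
Proof. by rewrite /= (nth_map c) ?size_enum_ord // nth_ord_enum. Qed.

Lemma bank_set_word0 (g : {set 'I_n}) (a : int) : (forall c : 'I_n, a != (c : nat)%:Z) ->
  bank (set_word g) a = 0.
Proof.
case: a => // k kc; apply: nth_default; rewrite size_map size_enum_ord leqNgt.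
by apply/negP=> kn; have := kc (Ordinal kn); rewrite eqxx.
Qed.

Definition selection_time := (for_time W (2 * opcost) + for_time W select_time)%N.

Lemma runs_selection e s :
  small_memory K s -> context s -> input tau T s -> s bout =1 (fun=> 0) ->
  d = `|e| ->
  (forall i : 'I_m, exists2 k, k \in tau & col k T = e *: delta_mx i 0) ->
  runs selection selection_time s (fun s' => exists g : {set 'I_n},
    [/\ s' bout =1 bank (set_word g), tau \subset g,
        forall c, span_on T g (col c T)
      & forall c, c \in g :\: tau -> ~ span_on T (g :\ c) (col c T)]).
Proof.
move=> ok sc sT s_out dE tauT; have [sm sn sd] := sc.
apply: runs_seq.
apply: (runs_fill K_gt0 (N := n) (f := fun c => (c : nat)%:Z) (g := fun=> 1)) => //.
- exact: ord_int_inj.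
- by move=> c s' ok' vc F other; split=> //; rewrite /small expn_gt0.
move=> s1 ok1 F1 val1 other1 _.
pose I (k : nat) s' :=
  same_off [:: bout; bH; bv; btmp; bq; bflag; bj; bi; bc; br; bt] s s' /\
  exists g : {set 'I_n},
    [/\ s' bout =1 bank (set_word g), tau \subset g,
        forall c : 'I_n, (k <= c)%N -> c \in g,
        forall c, span_on T g (col c T)
      & forall c, c \in g :\: tau -> (c < k)%N -> ~ span_on T (g :\ c) (col c T)].
apply: (runs_for K_gt0 (N := n) (I := I)) => //.
- by move=> k s' [F _]; rewrite F.
- move=> k s' z [F [g [out tg kg cov irr]]]; split; first exact: same_off_update F _.
  by exists g; split=> // a; rewrite update_off.
- split; first by apply: same_off_sub F1.
  exists setT; split=> // [|c _|c]; rewrite ?inE //; last by apply: span_on_col; rewrite inE.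
  apply: bank_set_word => [c|a ac]; first by rewrite val1 inE.
  by rewrite other1 // s_out.
- move=> j s' ok' vj [F [g [out tg kg cov irr]]].
  have s'c := context_same F sc isT.
  have s'T : input tau T s' by apply: input_same F sT.
  have outE (c : 'I_n) : s' bout (c : nat) = (c \in g) by rewrite out bank_set_wordE.
  have jg : j \in g by apply: kg.
  apply: runs_weaken (runs_select_step ok' s'c s'T vj outE jg) (leqnn _) _.
  move=> s2 ok2 [F2 [flag flE out2]]; split; first by rewrite F2.
  split; first by apply: same_off_trans F F2.
  (* For [j] outside [tau] the set [g :\ j] still contains [tau], so working modulo [d] does not
     enlarge its lattice. *)
  have mod_span : j \notin tau -> ~~ flag <-> span_on T (g :\ j) (col j T).
    move=> jt; rewrite flE (modlat_span _ _ dE tauT) //.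
    by apply/subsetP=> c ct; rewrite !inE (subsetP tg) // andbT; apply: contraNneq jt => <-.
  have [keep|] := boolP (flag || (j \in tau)).
    exists g; split=> // [a|c /ltnW/kg //|c cgt].
      by rewrite out2 keep -out; case: eqP => // ->; rewrite outE jg.
    rewrite ltnS leq_eqVlt => /orP[/eqP/val_inj cj|]; last exact: irr.
    rewrite cj in cgt *; have jt : j \notin tau by move: cgt; rewrite inE => /andP[].
    by move=> /(mod_span jt); rewrite (negPf jt) orbF in keep; rewrite keep.
  rewrite negb_or => /andP[nflag jt]; have span_j := (mod_span jt).1 nflag.
  exists (g :\ j); split.
  + apply: bank_set_word => [c|a ac].
      rewrite out2 (negPf nflag) (negPf jt) eqz_nat val_eqE !inE outE.
      by case: eqP.
    by rewrite out2 (negPf (ac j)) out bank_set_word0.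
  + by apply/subsetP=> c ct; rewrite !inE (subsetP tg) // andbT; apply: contraNneq jt => <-.
  + move=> c jc; rewrite !inE kg ?andbT; last exact: ltnW.
    by apply: contraTneq jc => ->; rewrite ltnn.
  + move=> c; apply: span_on_cols (cov c) => c' c'g.
    have [->//|c'j] := eqVneq c' j.
    by apply: span_on_col; rewrite !inE c'j.
  + move=> c; rewrite !inE => /and3P[ct cj cg]; rewrite ltnS leq_eqVlt => /orP[/eqP/val_inj cj'|cj'].
      by rewrite cj' eqxx in cj.
    (* Irredundance of the earlier columns survives later deletions, since these only shrink the
       lattices. *)
    move=> sp; apply: (irr c) => //; first by rewrite inE ct.
    by apply: span_on_sub sp; apply: setSD; apply: subD1set.
move=> s' _ [_ [g [out tg _ cov irr]]]; exists g; split=> // c cgt.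
exact: irr.
Qed.

End Select.

(** * Polynomial running time *)

Definition polynomial_time (f : nat -> nat) := exists p : {poly nat}, forall w, f w = p.[w].

Lemma polynomial_const k : polynomial_time (fun=> k).
Proof. by exists k%:P => w; rewrite hornerC. Qed.

Lemma polynomial_id : polynomial_time id.
Proof. by exists 'X => w; rewrite hornerX. Qed.

Lemma polynomialD f g : polynomial_time f -> polynomial_time g ->
  polynomial_time (fun w => f w + g w)%N.
Proof. by move=> [p pE] [q qE]; exists (p + q) => w; rewrite hornerD pE qE. Qed.

Lemma polynomialM f g : polynomial_time f -> polynomial_time g ->
  polynomial_time (fun w => f w * g w)%N.
Proof. by move=> [p pE] [q qE]; exists (p * q) => w; rewrite hornerM pE qE. Qed.

Lemma polynomial_for f : polynomial_time f -> polynomial_time (fun w => for_time w (f w)).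
Proof.
move=> pf; apply: (@polynomialD (fun=> 2 * opcost)%N); first exact: polynomial_const.
apply: (@polynomialD _ (fun=> opcost)); last exact: polynomial_const.
apply: (@polynomialM id); first exact: polynomial_id.
apply: (@polynomialD (fun=> opcost)); first exact: polynomial_const.
by apply: (@polynomialD f (fun=> 2 * opcost)%N) => //; apply: polynomial_const.
Qed.

Ltac prove_polynomial :=
  lazymatch goal with
  | |- polynomial_time (fun w => w) => exact polynomial_id
  | |- polynomial_time (fun w => for_time w (@?f w)) =>
      apply (@polynomial_for f); prove_polynomial
  | |- polynomial_time (fun w => addn (@?f w) (@?g w)) =>
      apply (@polynomialD f g); prove_polynomial
  | |- polynomial_time (fun w => muln (@?f w) (@?g w)) =>
      apply (@polynomialM f g); prove_polynomial
  | |- polynomial_time (fun w => ?k) => exact (polynomial_const k)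
  end.

(** With entries at most 2^w and m at most w, the minors are at most m! 2^(w m), hence at most 2^(2
    w^2); the summand 1 keeps the exponent positive. *)
Definition word_exponent (w : nat) : nat := (2 * (w * w) + 1)%N.

Definition total_time (w : nat) : nat :=
  ((elimination_time w + selection_time (word_exponent w) w) * word_exponent w)%N.

Lemma polynomial_total_time : polynomial_time total_time.
Proof.
rewrite /total_time /elimination_time /selection_time /pivot_time /search_time
  /select_time /insert_column_time /insert_time /euclid_time /fill_time /word_exponent.
by prove_polynomial.
Qed.

Lemma bitsize_gt z k : (bitsize z <= k)%N -> (`|z| <= 2 ^ k)%N.
Proof.
move=> zk; have := up_logP (p := 2) `|z|.+1 isT; move=> /ltnW/leq_trans; apply.
by rewrite leq_exp2l // ltnW.
Qed.

Lemma bitsize_word (w : seq int) z : z \in w -> (bitsize z <= word_size w)%N.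
Proof. by move=> zw; rewrite /word_size (big_rem z) //= leq_addr. Qed.

Lemma size_word (w : seq int) : (size w <= word_size w)%N.
Proof. by rewrite -sum1_size; apply: leq_sum. Qed.

Lemma nth_allpairs_enum m n (A : 'M[int]_(m, n)) (w : seq int) (i : 'I_m) (c : 'I_n) :
  nth 0 ([seq A i j | i <- enum 'I_m, j <- enum 'I_n] ++ w) (i * n + c) = A i c.
Proof.
have main (s : seq 'I_m) k : (k < size s)%N ->
    nth 0 ([seq A i j | i <- s, j <- enum 'I_n] ++ w) (k * n + c) = A (nth i s k) c.
  elim: s k => // x s IH k; rewrite /= -catA nth_cat size_map size_enum_ord.
  case: k => [|k] ks; first by rewrite mul0n add0n ltn_ord (nth_map c) ?size_enum_ord // nth_ord_enum.
  rewrite mulSn -addnA.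
  by rewrite ltnNge leq_addr /= addKn IH.
by rewrite main ?size_enum_ord // nth_ord_enum.
Qed.

Lemma fact_exp m : (m`! <= 2 ^ (m * m))%N.
Proof.
elim: m => // m IH; rewrite factS; apply: leq_trans (leq_mul (ltnW (ltn_expl m.+1 (isT : 1 < 2)%N)) IH) _.
by rewrite -expnD leq_exp2l //; lia.
Qed.

(** * Size bounds for a given input *)

Section Instance.
Variables (m n : nat) (A : 'M[int]_(m, n)) (tau : {set 'I_n}).
Hypotheses (m_gt0 : (0 < m)%N) (le_mn : (m <= n)%N).

Let word := instance_word A tau.
Let W := word_size word.
Let K := word_exponent W.

(** The characteristic vector alone occupies [n] cells, so the input size also bounds the number of
    iterations of every counting loop. *)
Lemma columns_word : (n <= W)%N.
Proof.
apply: leq_trans (size_word _); rewrite /= size_cat size_map size_enum_ord.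
by rewrite -2!addSn leq_addl.
Qed.

Lemma word_small z : z \in word -> small K z.
Proof.
move=> /bitsize_word/bitsize_gt zW; apply: leq_trans zW _; rewrite leq_exp2l // /K /word_exponent.
by rewrite -/W; nia.
Qed.

Lemma init_small : small_memory K (init_memory word).
Proof.
move=> [|b] //= [k|k] //=; have [kw|kw] := ltnP k (size word).
  by apply: word_small; apply: mem_nth.
by rewrite nth_default.
Qed.

Lemma init_input : input tau A (init_memory word).
Proof.
split=> // [i c|c]; first exact: nth_allpairs_enum.
rewrite /= nth_cat size_allpairs !size_enum_ord add0n ltnNge leq_addr /= addKn.
by rewrite (nth_map c) ?size_enum_ord // nth_ord_enum.
Qed.

Lemma entry_word i j : A i j \in word.
Proof.
rewrite !inE mem_cat; apply/orP; right; apply/orP; right; apply/orP; left.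
by apply: allpairs_f; rewrite mem_enum.
Qed.

Lemma pivot_small j T d : pivot_inv A tau j T d -> small K d /\ forall r c, small K (T r c).
Proof.
have X_gt0 : (0 < 2 ^ W)%N by rewrite expn_gt0.
have AX r c : `|A r c| <= (2 ^ W)%N%:Z.
  by have := bitsize_gt (bitsize_word (entry_word r c)); rewrite -/W; lia.
have UK : (m`! * (2 ^ W) ^ m <= 2 ^ K)%N.
  apply: leq_trans (leq_mul (fact_exp m) (leqnn _)) _.
  rewrite -expnM -expnD leq_exp2l // /K /word_exponent.
  by have := leq_trans le_mn columns_word; nia.
move=> /(pivot_inv_bound X_gt0 AX)[dU TU]; split=> [|r c].
  by apply: leq_trans UK; lia.
by apply: leq_trans UK; have := TU r c; lia.
Qed.

Lemma computes_gamma : #|tau| = m -> minor A tau != 0 ->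
  exists gamma : {set 'I_n},
    [/\ tau \subset gamma,
        forall v : 'cV[int]_m, lattice A v <-> lattice (cols A gamma) v,
        (#|gamma| <= m + trunc_Omega m (`|minor A tau| %/ gcd_minors A))%N
      & computes_within (Seq elimination selection) word (set_word gamma) (total_time W)].
Proof.
move=> tau_m minor0.
have K_gt0 : (0 < K)%N by rewrite /K /word_exponent addn1.
have nW := columns_word.
have nK : (n <= 2 ^ K)%N.
  apply: leq_trans nW _; apply: leq_trans (ltnW (ltn_expl W (isT : 1 < 2)%N)) _.
  by rewrite leq_exp2l // /K /word_exponent; nia.
(* The set [gamma] is extracted from the final memory, so existence and computation are obtained
   together. *)
have [s [t [ex tT _ [gamma [out tg cov irr]]]]] :
    runs K (Seq elimination selection) (elimination_time W + selection_time K W)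
      (init_memory word) (fun s => exists gamma : {set 'I_n},
      [/\ s 1%N =1 bank (set_word gamma), tau \subset gamma,
        forall c, span_on A gamma (col c A)
      & forall c, c \in gamma :\: tau -> ~ span_on A (gamma :\ c) (col c A)]).
  apply: runs_seq.
  apply: runs_weaken (runs_elimination K_gt0 m_gt0 le_mn nW nK tau_m minor0 pivot_small init_small init_input) (leqnn _) _.
  move=> s1 ok1 [F1 [T [d [e [s1T inv dE s1d]]]]] _.
  have [e0 tauT spanE] := pivot_invE inv.
  have d_gt0 : 0 < d by rewrite dE normr_gt0.
  have d_small : small K d by have [+ _] := pivot_small inv; rewrite dE -abszE.
  have s1c : context m n d s1 by case: s1T.
  have s1o : s1 1%N =1 (fun=> 0) by move=> a; rewrite F1.
  apply: runs_weaken (runs_selection K_gt0 m_gt0 le_mn nW nK d_gt0 d_small ok1 s1c s1T s1o dE tauT) (leqnn _) _.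
  move=> s2 ok2 [g [out tg cov irr]]; exists g; split=> // c; first by apply/spanE.
  by move=> cgt /spanE; apply: irr.
have latE v : lattice A v -> span_on A gamma v.
  by move=> [x ->]; apply: (span_on_cols (X := setT)) => //; exists x => // c; rewrite inE.
exists gamma; split=> //.
- move=> v; rewrite lattice_cols; split=> [/latE //|[x _ ->]]; by exists x.
- exact: irredundant_bound.
- by exists s, t; split.
Qed.

End Instance.

Theorem theorem1 :
  (forall (m n : nat) (A : 'M[int]_(m, n)) (tau : {set 'I_n}),
     (0 < m)%N -> (m <= n)%N -> #|tau| = m -> minor A tau != 0 ->
     exists gamma : {set 'I_n},
       [/\ tau \subset gamma,
           forall v : 'cV[int]_m, lattice A v <-> lattice (cols A gamma) v &
           (#|gamma| <=
              m + trunc_Omega m (`|minor A tau| %/ gcd_minors A))%N])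
  /\
  (exists (c : cmd) (p : {poly nat}),
     forall (m n : nat) (A : 'M[int]_(m, n)) (tau : {set 'I_n}),
     (0 < m)%N -> (m <= n)%N -> #|tau| = m -> minor A tau != 0 ->
     exists gamma : {set 'I_n},
       [/\ tau \subset gamma,
           forall v : 'cV[int]_m, lattice A v <-> lattice (cols A gamma) v,
           (#|gamma| <=
              m + trunc_Omega m (`|minor A tau| %/ gcd_minors A))%N &
           computes_within c (instance_word A tau) (set_word gamma)
             p.[word_size (instance_word A tau)]]).
Proof.
split=> [m n A tau m_gt0 le_mn tau_m minor0|].
  have [gamma [tg latE bound _]] := computes_gamma m_gt0 le_mn tau_m minor0.
  by exists gamma.
have [p pE] := polynomial_total_time.
exists (Seq elimination selection), p => m n A tau m_gt0 le_mn tau_m minor0.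
by rewrite -pE; apply: computes_gamma.
Qed.
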